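(* Let $E$ be a Polish space, $n\ge1$, $C>0$. If the law $P$ of $X=(X_1,\dots,X_n)$ on $E^n$ satisfies $\tilde T_{2,1_2}(C)$ and $\tilde T^{(i)}_{2,1_2}(C)$, then for every measurable set $A\subset E^n$ (with $1/0=+\infty$) $$P\Big[\exp\Big(\frac{d_T^2(X,A)}{4C}\Big)\Big]\le\frac1{P(A)}.$$
   Context: Notation: $P[h]=\int h\,dP$; $\mathcal K(Q|P)=Q[\log(dQ/dP)]$; $M^+(F)$ is the set of non-negative lower semi-continuous functions on $F$; convention $+\infty/+\infty=0/0=0$. For $x\in E^n$ and $A\subset E^n$, $$d_T(x,A)=\sup_{\|c\|\le1}\ \inf_{y\in A}\ \sum_{j=1}^nc_j1_{x_j\ne y_j},$$ the supremum being over $c\in\mathbb R^n$ with Euclidean norm at most $1$. For probability measures $P,Q$ on $E^n$, $$\tilde W_{2,1_2}(P,Q)=\sup_{\alpha=(\alpha_j)_{1\le j\le n},\ \alpha_j\in M^+(E^n)}\ \inf_\pi\ \frac{\sum_{j=1}^n\pi[\alpha_j(Y)1_{X_j\ne Y_j}]}{\big(\sum_{j=1}^nQ[\alpha_j(Y)^2]\big)^{1/2}},$$ the infimum being over couplings $\pi$ of $(X,Y)$ with $X\sim P$, $Y\sim Q$. $P$ satisfies $\tilde T_{2,1_2}(C)$ if $\tilde W_{2,1_2}(P,Q)\le\sqrt{2C\mathcal K(Q|P)}$ for all probability measures $Q$ on $E^n$; it satisfies $\tilde T^{(i)}_{2,1_2}(C)$ if $\tilde W_{2,1_2}(Q,P)\le\sqrt{2C\mathcal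 K(Q|P)}$ for all $Q$. (The subscript $1_2$ refers to $1_2(x,y)^2=\sum_j1_{x_j\ne y_j}$.) *)

(* Defs.v *)
From HB Require Import structures.
From mathcomp Require Import all_boot all_order all_algebra.
From mathcomp Require Import all_classical all_reals all_analysis.

Set Implicit Arguments.
Unset Strict Implicit.
Unset Printing Implicit Defensive.

Import Order.TTheory GRing.Theory Num.Theory.
Import numFieldNormedType.Exports.

Local Open Scope classical_set_scope.
Local Open Scope ring_scope.

Definition is_metric (R : realType) (T : Type) (d : T -> T -> R) : Prop :=
  [/\ forall x y, d x y = 0 <-> x = y,
      forall x y, d x y = d y x &
      forall x y z, d x z <= d x y + d y z].

Definition metrizes (R : realType) (T : topologicalType)
    (d : T -> T -> R) : Prop :=
  forall (x : T) (A : set T),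
    nbhs x A <-> exists2 e : R, 0 < e & [set y | d x y < e] `<=` A.

Definition is_complete_metric (R : realType) (T : topologicalType)
    (d : T -> T -> R) : Prop :=
  forall u : nat -> T,
    (forall e : R, 0 < e -> exists N : nat, forall i k : nat,
        (N <= i)%N -> (N <= k)%N -> d (u i) (u k) < e) ->
    exists l : T, u @ \oo --> l.

Definition polish_space (R : realType) (T : topologicalType) : Prop :=
  (exists2 D : set T, countable D & dense D) /\
  (exists d : T -> T -> R,
     [/\ is_metric d, metrizes d & is_complete_metric d]).

(* E^n with the product topology, and the same set with the Borel sigma-algebra
   of that topology. Later on E is pointed because the library generates
   sigma-algebras on pointed types only; for n >= 1 this excludes just the empty
   space, on which there is no probability measure. *)
Notation topPower E n := (prod_topology (fun _ : 'I_n => E)).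
Notation borelPower E n := (g_sigma_algebraType (@open (topPower E n))).

Local Open Scope ereal_scope.

(* K(Q|P) = Q[log(dQ/dP)], equal to +oo when dQ/dP does not exist. *)
Definition relative_entropy (R : realType) (d : measure_display)
    (T : measurableType d) (Q P : probability T R) : \bar R :=
  if `[< Q `<< P >] then
    \int[Q]_x lne (Radon_Nikodym (charge_of_finite_measure Q) P x)
  else +oo.

(* Marginals are compared on measurable sets only: the value of a measure on a
   non-measurable set is unspecified. *)
Definition is_coupling (R : realType) (d : measure_display)
    (T : measurableType d) (P Q : probability T R)
    (pi : probability (T * T)%type R) : Prop :=
  forall A : set T, measurable A ->
    pi (fst @^-1` A) = P A /\ pi (snd @^-1` A) = Q A.

Definition nonneg_lsc (R : realType) (F : topologicalType)
    (f : F -> R) : Prop :=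
  (forall x, (0 <= f x)%R) /\ lower_semicontinuous (EFin \o f).

(* On nonnegative extended reals the library's x / y is x * y^-1 with
   0^-1 = +oo, +oo^-1 = 0 and 0 * +oo = 0, so that +oo / +oo = 0 / 0 = 0. *)
Definition weak_cost (R : realType) (E : ptopologicalType) (n : nat)
    (Q : probability (borelPower E n) R)
    (alpha : 'I_n -> topPower E n -> R)
    (pi : probability (borelPower E n * borelPower E n)%type R) : \bar R :=
  (\sum_(j < n) \int[pi]_p (alpha j p.2 * (p.1 j != p.2 j)%:R)%:E)
  / sqrte (\sum_(j < n) \int[Q]_y ((alpha j y) ^+ 2)%:E).

Definition weak_W (R : realType) (E : ptopologicalType) (n : nat)
    (P Q : probability (borelPower E n) R) : \bar R :=
  ereal_sup
    [set ereal_inf [set weak_cost Q alpha pi | pi in is_coupling P Q]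
    | alpha in [set alpha : 'I_n -> topPower E n -> R |
                forall j, nonneg_lsc (alpha j)]].

Definition weak_T (R : realType) (E : ptopologicalType) (n : nat) (C : R)
    (P : probability (borelPower E n) R) : Prop :=
  forall Q : probability (borelPower E n) R,
    weak_W P Q <= sqrte ((2 * C)%:E * relative_entropy Q P).

Definition weak_T_inv (R : realType) (E : ptopologicalType) (n : nat) (C : R)
    (P : probability (borelPower E n) R) : Prop :=
  forall Q : probability (borelPower E n) R,
    weak_W Q P <= sqrte ((2 * C)%:E * relative_entropy Q P).

(* Extended-real valued: the infimum over an empty A is +oo. As a function of x
   it need not be Borel when A is, only universally measurable (its sublevel
   sets are analytic). The library's integral of a nonnegative function, a
   supremum over the measurable simple functions below it, then agrees with the
   integral against the completed measure. *)
Definition talagrand_dist (R : realType) (E : ptopologicalType) (n : nat)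
    (x : topPower E n) (A : set (topPower E n)) : \bar R :=
  ereal_sup
    [set ereal_inf [set (\sum_(j < n) c j * (x j != y j)%:R)%:E | y in A]
    | c in [set c : 'I_n -> R |
            (Num.sqrt (\sum_(j < n) c j ^+ 2) <= 1)%R]].

(* Main.v *)
(* The Gibbs variational principle reduces the claim to the inequality
   Q[d_T(., K)^2] <= 4C (H(P_K|P) + H(Q|P)) for Q << P, where P_K is P conditioned
   on a compact set K contained in A.  It follows from
   Q[d_T^2]^(1/2) <= W(P_K, P) + W(P, Q), taking in the definition of W the weights
   d_T(y, K) c(y), with c(y) optimal in the definition of d_T(y, K).

   Everything depends on a point x only through the finite collection of sets of
   coordinates on which x differs from some point of K.  For compact K this
   collection is a measurable function of x, so the densities, the weights and the
   conditional expectations involved are finite-valued.  In particular the weights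
   for the coupling of P_K and P are the conditional means, given the collection at
   the first point, of the weights for the coupling of P and Q; this proves the
   triangle inequality without gluing the two couplings. *)

Require Import Defs.
From HB Require Import structures.
From mathcomp Require Import all_boot all_order all_algebra.
From mathcomp Require Import all_classical all_reals all_analysis.
From mathcomp Require Import measurable_realfun ring lra.

Set Implicit Arguments.
Unset Strict Implicit.
Unset Printing Implicit Defensive.

Import Order.TTheory GRing.Theory Num.Theory.
Import numFieldNormedType.Exports.

Local Open Scope classical_set_scope.
Local Open Scope ring_scope.

(** * Transport between finite spaces *)

(** Expanding the non-negative sum of [m i * (a i - q / p) ^+ 2] gives this form of Jensen's
    inequality for weights of arbitrary total mass [p]. *)
Lemma weighted_mean_sqr_le (R : realType) (I : finType) (m a : I -> R) :
  (forall i, 0 <= m i) ->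
  (\sum_i m i) * ((\sum_i m i * a i) / \sum_i m i) ^+ 2
    <= \sum_i m i * a i ^+ 2.
Proof.
move=> m0; set p := \sum_i m i; set q := \sum_i _ * a _.
have [p0|p0] := eqVneq p 0.
  by rewrite p0 mul0r; apply: sumr_ge0 => i _; rewrite mulr_ge0 ?sqr_ge0.
have : 0 <= \sum_i m i * (a i - q / p) ^+ 2.
  by apply: sumr_ge0 => i _; rewrite mulr_ge0 ?sqr_ge0.
have exp c : \sum_i m i * (a i - c) ^+ 2 =
    \sum_i m i * a i ^+ 2 - 2 * c * q + p * c ^+ 2.
  rewrite /p /q mulr_sumr -sumrB mulr_suml -big_split /=.
  by apply: eq_bigr => i _; ring.
rewrite exp.
have -> : 2 * (q / p) * q = 2 * (p * (q / p) ^+ 2) by field.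
lra.
Qed.

Section finite_transport.
Variables (R : realType) (n : nat).
Local Notation D := {set 'I_n}.
Local Notation F := {set {set 'I_n}}.
Variables (r : F -> F -> D -> R) (a : F -> 'I_n -> R).
Hypothesis r_ge0 : forall S T d, 0 <= r S T d.

Definition first_marginal (S : F) : R := \sum_T \sum_d r S T d.

(** Conditional expectation of [a T j] given [S] under the joint weights [r]; it is 0 on classes of
    zero mass, since division by zero gives 0. *)
Definition cond_mean (S : F) (j : 'I_n) : R :=
  (\sum_T (\sum_d r S T d) * a T j) / first_marginal S.

Lemma cond_mean_ge0 S j : (forall T j, 0 <= a T j) -> 0 <= cond_mean S j.
Proof.
move=> a0; rewrite divr_ge0//.
  by apply: sumr_ge0 => T _; rewrite mulr_ge0// sumr_ge0.
by apply: sumr_ge0 => T _; rewrite sumr_ge0.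
Qed.

Lemma cond_mean_sqr_le :
  \sum_S first_marginal S * (\sum_j cond_mean S j ^+ 2)
    <= \sum_S \sum_T \sum_d r S T d * (\sum_j a T j ^+ 2).
Proof.
apply: ler_sum => S _.
have -> : \sum_T \sum_d r S T d * (\sum_j a T j ^+ 2) =
    \sum_j \sum_T (\sum_d r S T d) * a T j ^+ 2.
  rewrite [RHS]exchange_big /=; apply: eq_bigr => T _.
  by rewrite -mulr_suml mulr_sumr.
rewrite mulr_sumr; apply: ler_sum => j _.
by apply: weighted_mean_sqr_le => T; apply: sumr_ge0.
Qed.

(* Replaces the triangle inequality for the transport cost: the coupling [q] is
   used only with the weights [cond_mean], which are constant on the classes of
   the first coordinate of [r], so [q] and [r] need not be glued. *)
Lemma finite_transport (q : F -> D -> R) (v : F -> R) :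
  (forall S d, 0 <= q S d) ->
  (forall S, \sum_d q S d = first_marginal S) ->
  (forall S d, q S d != 0 -> d \in S) ->
  (forall (T : F) s, s \in T -> v T <= \sum_(j in s) a T j) ->
  (forall T j, 0 <= a T j) ->
  (forall S T d s, r S T d != 0 -> s \in S -> s :|: d \in T) ->
  \sum_S \sum_T \sum_d r S T d * v T <=
    \sum_S \sum_d q S d * (\sum_(j in d) cond_mean S j) +
    \sum_S \sum_T \sum_d r S T d * (\sum_(j in d) a T j).
Proof.
move=> q0 qp qS va a0 rST; rewrite -big_split /=; apply: ler_sum => S _.
have [p0|p0] := eqVneq (first_marginal S) 0.
  have r0 T d : r S T d = 0.
    have := psumr_eq0P _ p0 (i := T); rewrite -/(_ -> _) => h.
    have {}h : \sum_d r S T d = 0.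
      by apply: h => // T' _; apply: sumr_ge0.
    by apply: (psumr_eq0P _ h).
  rewrite big1 => [|T _]; last by rewrite big1// => d _; rewrite r0 mul0r.
  rewrite addr_ge0//.
    apply: sumr_ge0 => d _; rewrite mulr_ge0//.
    by apply: sumr_ge0 => j _; apply: cond_mean_ge0.
  by apply: sumr_ge0 => T _; apply: sumr_ge0 => d _; rewrite r0 mul0r.
have [d0 d0S] : exists d, d \in S.
  have : ~~ [forall d, q S d == 0].
    apply: contra p0 => /forallP h; rewrite -qp big1// => d _.
    by apply/eqP.
  by rewrite negb_forall => /existsP[d /qS]; exists d.
(* One cheapest pattern [s] of the class serves for every [T]: its cost times the mass of [S] is at
   most the [q]-cost, as [q] charges only patterns of [S], and [s :|: d] is a pattern of the class
   [T]. *)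
have [s sS smin] := arg_minP (fun d : D => \sum_(j in d) cond_mean S j) d0S.
have le1 : \sum_T \sum_d r S T d * \sum_(j in s) a T j <=
    \sum_d q S d * \sum_(j in d) cond_mean S j.
  have -> : \sum_T \sum_d r S T d * \sum_(j in s) a T j =
      first_marginal S * \sum_(j in s) cond_mean S j.
    under eq_bigr do rewrite -mulr_suml mulr_sumr.
    rewrite exchange_big /= mulr_sumr; apply: eq_bigr => j _.
    by rewrite /cond_mean mulrC divfK.
  rewrite -qp mulr_suml; apply: ler_sum => d _.
  have [->|qd] := eqVneq (q S d) 0; first by rewrite !mul0r.
  by rewrite ler_wpM2l//; apply: smin; apply: qS.
apply: le_trans (lerD le1 (lexx _)); rewrite -big_split /=.
apply: ler_sum => T _; rewrite -big_split /=; apply: ler_sum => d _.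
rewrite -mulrDr; have [->|rd] := eqVneq (r S T d) 0; first by rewrite !mul0r.
rewrite ler_wpM2l//; apply: le_trans (va _ _ (rST _ _ _ _ rd sS)) _.
rewrite [leLHS]big_mkcond [X in X + _]big_mkcond [X in _ + X]big_mkcond /=.
rewrite -big_split /=; apply: ler_sum => j _; rewrite inE.
by case: (j \in s); case: (j \in d); rewrite /= ?addr0 ?add0r ?lerDl.
Qed.

End finite_transport.

(** * Measures with a finite-valued density *)

Section finite_valued.
Context (dT : measure_display) (T : measurableType dT) (R : realType).
Variables (I : finType) (tau : T -> I).
Hypothesis mtau : forall t, measurable (tau @^-1` [set t]).
Implicit Type mu : probability T R.

Definition law mu (t : I) : R := fine (mu (tau @^-1` [set t])).

Lemma law_ge0 mu t : 0 <= law mu t.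
Proof. exact: fine_ge0. Qed.

Lemma lawE mu t : (law mu t)%:E = mu (tau @^-1` [set t]).
Proof. by rewrite fineK// fin_num_measure. Qed.

Let comp_sum_indic (g : I -> R) :
  (fun x => (g (tau x))%:E) =
  (fun x => \sum_t (g t)%:E * (\1_(tau @^-1` [set t]) x)%:E)%E.
Proof.
apply/funext => x; rewrite (bigD1 (tau x))//= indicE mem_set// mule1.
rewrite big1 ?adde0// => t tx; rewrite indicE memNset ?mule0// => /esym/eqP.
by apply/negP.
Qed.

Lemma measurable_finite_preimage (A : set I) : measurable (tau @^-1` A).
Proof.
rewrite (_ : tau @^-1` A = \bigcup_(t in A) tau @^-1` [set t]).
  by apply: fin_bigcup_measurable => //; exact: finite_finset.
by apply/seteqP; split=> [x Ax|x [t At /= ->]//]; exists (tau x).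
Qed.

Lemma measurable_finite_comp (g : I -> R) :
  measurable_fun [set: T] (fun x => (g (tau x))%:E).
Proof.
rewrite comp_sum_indic; apply: emeasurable_sum => t.
by apply: measurable_funeM; apply/measurable_EFinP; exact: measurable_indic.
Qed.

Lemma integrable_finite_comp mu (g : I -> R) :
  mu.-integrable setT (fun x => (g (tau x))%:E).
Proof.
rewrite comp_sum_indic; apply: integrable_sum => // t _.
by apply: integrableZl => //; exact: integrable_indic.
Qed.

Lemma integral_finite_comp mu (g : I -> R) :
  (\int[mu]_x (g (tau x))%:E)%E = (\sum_t law mu t * g t)%:E.
Proof.
rewrite comp_sum_indic integral_sum//; last first.
  by move=> t; apply: integrableZl => //; exact: integrable_indic.
rewrite -sumEFin; apply: eq_bigr => t _.
rewrite integralZl//; last exact: integrable_indic.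
by rewrite integral_indic// setIT mulrC EFinM lawE.
Qed.

Lemma sum_law mu : \sum_t law mu t = 1.
Proof.
have := integral_finite_comp mu (fun=> 1).
have -> : (\int[mu]_x 1%:E = 1)%E.
  by rewrite integral_cst// mul1e; exact: probability_setT.
move=> -[->]; by apply: eq_bigr => t _; rewrite mulr1.
Qed.

Variables (P : probability T R) (g : I -> R).
Hypothesis g_ge0 : forall t, 0 <= g t.
Hypothesis sum_g : \sum_t law P t * g t = 1.

(** The proofs are arguments of the set function so that the measure and probability instances
    declared below can recover them from the term itself. *)
Definition finite_density (_ : forall t, 0 <= g t)
    (_ : forall t, measurable (tau @^-1` [set t]))
    (_ : \sum_t law P t * g t = 1) (A : set T) : \bar R :=
  (\int[P]_(x in A) (g (tau x))%:E)%E.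

Local Notation Q := (finite_density g_ge0 mtau sum_g).

Let Q0 : Q set0 = 0%E.
Proof. by rewrite /finite_density integral_set0. Qed.

Let Q_ge0 A : (0 <= Q A)%E.
Proof. by apply: integral_ge0 => x _; rewrite lee_fin. Qed.

Let Q_sigma_additive : semi_sigma_additive Q.
Proof.
apply: semi_sigma_additive_nng_induced; first exact: measurable_finite_comp.
by move=> x; rewrite lee_fin.
Qed.

HB.instance Definition _ := isMeasure.Build _ _ _ Q Q0 Q_ge0 Q_sigma_additive.

Let Q_setT : Q setT = 1%E.
Proof. by rewrite /finite_density integral_finite_comp sum_g. Qed.

HB.instance Definition _ := Measure_isProbability.Build _ _ _ Q Q_setT.

Lemma finite_density_dominates : Q `<< P.
Proof.
apply/null_content_dominatesP => A mA PA0.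
apply: null_set_integral => //.
by apply: measurable_funTS; exact: measurable_finite_comp.
Qed.

Lemma law_finite_density t : law Q t = law P t * g t.
Proof.
apply: EFin_inj; rewrite lawE /= /finite_density.
rewrite (eq_integral (fun=> (g t)%:E)); last first.
  by move=> x; rewrite inE => /= ->.
by rewrite integral_cst// mulrC EFinM lawE.
Qed.

(** The Radon-Nikodym derivative equals [g \o tau] almost everywhere for [P], hence for the
    dominated [Q], and the entropy integral becomes a finite sum. *)
Lemma relative_entropy_finite_density :
  relative_entropy Q P = (\sum_t law P t * g t * ln (g t))%:E.
Proof.
have QP := finite_density_dominates.
rewrite /relative_entropy; case: asboolP => // _.
set f := Radon_Nikodym _ P.
have mf : measurable_fun setT f.
  by apply: measurable_int; exact: Radon_Nikodym_integrable.
have fg : ae_eq P setT f (fun x => (g (tau x))%:E).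
  apply: integral_ae_eq => //; first exact: Radon_Nikodym_integrable.
    exact: measurable_finite_comp.
  by move=> A _ mA; rewrite -Radon_Nikodym_integral.
(* At a zero of [g], [lne] is -oo while [ln] is 0, but such points form a [Q]-null set. *)
have g0 : ae_eq Q setT (fun x => lne (g (tau x))%:E)
    (fun x => (ln (g (tau x)))%:E).
  exists (tau @^-1` [set t | g t == 0]); split.
  - exact: measurable_finite_preimage.
  - rewrite /= /finite_density integral0_eq// => x /= /eqP ->.
    by [].
  - move=> x /= h; apply/negPn/negP => gx; apply: h => _.
    by rewrite leNgt lt_def gx g_ge0.
rewrite (_ : (\sum_t _) = \sum_t law Q t * ln (g t)); last first.
  by apply: eq_bigr => t _; rewrite law_finite_density.
rewrite -integral_finite_comp.
apply: ae_eq_integral => //.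
(* For every real [r], [r < lne y] is equivalent to [expR r < y], which reduces the claim to
   measurability of [f]. *)
- apply: (measurability _ (ErealGenOInfty.measurableE R)) => // _ [_ [r ->] <-].
  rewrite [X in measurable X](_ : _ = setT `&` [set x | (expR r)%:E < f x]%E).
    exact: emeasurable_fun_o_infty.
  apply/seteqP; split => x /=; rewrite in_itv /= andbT => -[_].
    case: (f x) => [y| |] //=; last by move=> _; split=> //; rewrite ltry.
    case: (leP y 0) => // y0 ry.
    by split=> //; rewrite lte_fin -[y]lnK ?posrE// ltr_expR.
  case: (f x) => [y| |] //=; last by move=> _; split=> //; rewrite ltry.
  rewrite lte_fin => ry; split=> //; have y0 := lt_trans (expR_gt0 r) ry.
  by rewrite leNgt y0 /= lte_fin -ltr_expR lnK.
- exact: (measurable_finite_comp (fun t => ln (g t))).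
- have fgQ := null_dominates_ae_eq measurableT QP fg.
  rewrite /ae_eq; near=> x => _.
  have -> : f x = (g (tau x))%:E by near: x; apply: filterS fgQ => x; exact.
  by near: x; apply: filterS g0 => x; exact.
Unshelve. all: by end_near. Qed.

Lemma finite_density_exists : exists Q : probability T R,
  (forall t, law Q t = law P t * g t) /\
  relative_entropy Q P = (\sum_t law P t * g t * ln (g t))%:E.
Proof.
exists Q; split; first exact: law_finite_density.
exact: relative_entropy_finite_density.
Qed.

End finite_valued.

(** * Regularity of Borel probabilities *)

(** Continuity from above, applied to the differences, which decrease to the empty set. *)
Lemma exhaust_measure (dT : measure_display) (T : measurableType dT)
    (R : realType) (mu : probability T R) (F : (set T)^nat) (e : R) :
  (forall k, measurable (F k)) -> nondecreasing_seq F -> 0 < e ->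
  exists k, (mu ((\bigcup_k F k) `\` F k) < e%:E)%E.
Proof.
move=> mF ndF e0; pose G k := (\bigcup_k F k) `\` F k.
have mU : measurable (\bigcup_k F k) by apply: bigcup_measurable.
have mG k : measurable (G k) by apply: measurableD.
have : mu \o G @ \oo --> mu (\bigcap_k G k).
  apply: nonincreasing_cvg_mu => //; last first.
  - move=> i j ij; apply/subsetPset; apply: setDS.
    by have := ndF _ _ ij; move/subsetPset.
  - exact: bigcap_measurable.
  - by rewrite ltey_eq fin_num_measure.
have -> : \bigcap_k G k = set0.
  apply/seteqP; split=> // x h; have [[k _ Fkx] _] := h 0%N I.
  by have [_] := h k I.
rewrite measure0 => /fine_cvgP[_].
move/cvgr0Pnorm_lt => /(_ e e0)[N _ /(_ N (leqnn N))] /= h; exists N.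
rewrite -(@fineK _ (mu _)) ?fin_num_measure//; last exact: mG.
by rewrite lte_fin (le_lt_trans _ h)// ler_norm.
Qed.

Section metric.
Context (R : realType) (E : ptopologicalType) (n : nat) (d : E -> E -> R).
Hypothesis d_metric : is_metric d.
Hypothesis d_metrizes : metrizes d.
Local Notation X := (topPower E n).

Lemma is_metric_refl x : d x x = 0.
Proof. by case: d_metric => h _ _; apply/h. Qed.

Lemma is_metric_sym x y : d x y = d y x.
Proof. by case: d_metric. Qed.

Lemma is_metric_triangle x y z : d x z <= d x y + d y z.
Proof. by case: d_metric. Qed.

Lemma is_metric_ge0 x y : 0 <= d x y.
Proof.
have := is_metric_triangle x y x.
by rewrite is_metric_refl (is_metric_sym y x); lra.
Qed.

Lemma open_metric_ball x r : open [set y | d x y < r].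
Proof.
rewrite openE => y /= xy; apply/d_metrizes; exists (r - d x y); first lra.
by move=> z /= yz; have := is_metric_triangle x y z; lra.
Qed.

Lemma closed_metric_ball x r : closed [set y | d x y <= r].
Proof.
rewrite -openC openE => y /= /negP; rewrite -ltNge => xy.
apply/d_metrizes; exists (d x y - r); first lra.
move=> z /= yz; apply/negP; rewrite -ltNge.
by have := is_metric_triangle x z y; rewrite (is_metric_sym z y); lra.
Qed.

Lemma metrizable_hausdorff : hausdorff_space E.
Proof.
move=> x y cl; apply/eqP; apply: contrapT => /negP xy.
have dxy : 0 < d x y.
  rewrite lt_def is_metric_ge0 andbT; apply: contra_neq xy.
  by case: d_metric => h _ _ /h.
have nb z : nbhs z [set w | d z w < d x y / 2].
  by apply/d_metrizes; exists (d x y / 2) => //; lra.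
have [z [/= xz yz]] := cl _ _ (nb x) (nb y).
by have := is_metric_triangle x z y; rewrite (is_metric_sym z y); lra.
Qed.

Lemma continuous_topPower_coord (j : 'I_n) : continuous (fun x : X => x j).
Proof. exact: (@proj_continuous _ (fun=> E) j). Qed.

Lemma nbhs_topPower (F : set_system X) (x : X) : Filter F ->
  (forall j, (fun y : X => y j) @ F --> x j) -> F --> x.
Proof.
move=> FF h; apply/cvg_sup => j U [V] [[W] oW <-] WxV WU.
apply: (filterS WU); apply: (h j); exact: open_nbhs_nbhs.
Qed.

Lemma open_topPower_box (x : X) (U : set X) : open U -> U x ->
  exists k : nat, forall y : X, (forall j, d (x j) (y j) < k.+1%:R^-1) -> U y.
Proof.
move=> oU Ux.
(* [F] is the filter generated by the boxes around [x]; it converges in each coordinate, hence in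
   the product, and so contains [U]. *)
pose F : set_system X := fun A => exists k : nat,
  forall y : X, (forall j, d (x j) (y j) < k.+1%:R^-1) -> A y.
have FF : Filter F.
  split; first by exists 0%N.
    move=> A B [k Ak] [l Bl]; exists (maxn k l) => y h; split.
      apply: Ak => j; apply: (lt_le_trans (h j)).
      by rewrite lef_pV2 ?posrE// ler_nat ltnS leq_maxl.
    apply: Bl => j; apply: (lt_le_trans (h j)).
    by rewrite lef_pV2 ?posrE// ler_nat ltnS leq_maxr.
  by move=> A B AB [k Ak]; exists k => y /Ak /AB.
suff Fx : F --> x by exact: (Fx U (open_nbhs_nbhs (conj oU Ux))).
apply: nbhs_topPower.
move=> j A /d_metrizes[e e0 eA].
have [k] := ltr_add_invr e0; rewrite add0r => ke.
by exists k => y h; apply: eA => /=; apply: lt_trans ke.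
Qed.

(** The [k]-th closed set collects the points whose box of radius [k.+1%:R^-1] lies in [U]. Its
    complement is open: a point outside [U] in the box of [x] stays in the box under small moves of
    [x]. *)
Lemma open_topPower_Fsigma (U : set X) : open U ->
  exists F : nat -> set X, [/\ forall k, closed (F k), nondecreasing_seq F &
    \bigcup_k F k = U].
Proof.
move=> oU.
exists (fun k => [set x | forall y : X,
  (forall j, d (x j) (y j) < k.+1%:R^-1) -> U y]); split.
- move=> k; rewrite -openC openE => x /= /existsNP[y /not_implyP[h Uy]].
  have : nbhs x [set z : X | forall j, d (y j) (z j) < k.+1%:R^-1].
    apply: (@filter_forall _ _ (fun j (z : X) => d (y j) (z j) < k.+1%:R^-1)
      (nbhs x) _) => j.
    have := open_comp (fun x _ => @continuous_topPower_coord j x)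
      (open_metric_ball (y j) k.+1%:R^-1).
    move=> o; apply: open_nbhs_nbhs; split; first exact: o.
    by rewrite /= is_metric_sym.
  apply: filterS => z /= hz /(_ y); apply: contra_not Uy; apply => j.
  by rewrite is_metric_sym.
- move=> k l kl; apply/subsetPset => x /= h y hy; apply: h => j.
  by apply: (lt_le_trans (hy j)); rewrite lef_pV2 ?posrE// ler_nat ltnS.
- apply/seteqP; split=> [x [k _]|x Ux].
    by apply => j; rewrite is_metric_refl.
  by have [k h] := open_topPower_box oU Ux; exists k.
Qed.

Section regularity.
Variable mu : probability (borelPower E n) R.

Lemma open_borelPower (U : set X) : open U ->
  measurable (U : set (borelPower E n)).
Proof. exact: sub_sigma_algebra. Qed.

Lemma closed_borelPower (U : set X) : closed U ->
  measurable (U : set (borelPower E n)).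
Proof.
by move=> cU; rewrite -(setCK U); apply: measurableC; apply: open_borelPower;
  rewrite openC.
Qed.

Let regular (B : set (borelPower E n)) := forall e : R, 0 < e ->
  exists C O : set X, [/\ closed C, open O, C `<=` B, B `<=` O &
    (mu (O `\` C : set (borelPower E n)) < e%:E)%E].

Let regular_open (U : set X) : open U -> regular U.
Proof.
move=> oU e e0; have [F [cF ndF FU]] := open_topPower_Fsigma oU.
have [k mk] := @exhaust_measure _ (borelPower E n) _ mu F e
  (fun k => closed_borelPower (cF k)) ndF e0.
exists (F k), U; split => //; last by rewrite -[X in X `\` _]FU.
by rewrite -FU; apply: bigcup_sup.
Qed.

Let regularC B : regular B -> regular (~` B).
Proof.
move=> rB e /rB [C [V [cC oO cB bO OC]]]; exists (~` V), (~` C); split.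
- by rewrite -openC setCK.
- by rewrite openC.
- exact: subsetC.
- exact: subsetC.
- by rewrite (_ : _ `\` _ = V `\` C)// !setDE setCK setIC.
Qed.

Let regular_bigcup (B : (set (borelPower E n))^nat) :
  (forall k, regular (B k)) -> regular (\bigcup_k B k).
Proof.
move=> rB e e0.
(* These errors sum to [e / 2]; the other half pays for keeping only finitely many of the closed
   sets. *)
have e4 (k : nat) : 0 < e / 2 / (2 ^ k.+1)%:R.
  by rewrite !divr_gt0// ltr0n expn_gt0.
have /choice[CO /= COP] : forall k, exists CO : set X * set X,
    [/\ closed CO.1, open CO.2, CO.1 `<=` B k, B k `<=` CO.2 &
    (mu (CO.2 `\` CO.1 : set (borelPower E n)) <
      (e / 2 / (2 ^ k.+1)%:R)%:E)%E].
  by move=> k; have [C [V h]] := rB k _ (e4 k); exists (C, V).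
pose C k := (CO k).1; pose O k := (CO k).2.
have cC k : closed (C k) by case: (COP k).
have oO k : open (O k) by case: (COP k).
have mC k : measurable (C k : set (borelPower E n)) by exact: closed_borelPower.
have mO k : measurable (O k : set (borelPower E n)) by exact: open_borelPower.
pose F k := \big[setU/set0]_(i < k.+1) C i.
have cF k : closed (F k) by apply: closed_bigsetU => i _; exact: cC.
have FC : \bigcup_k F k = \bigcup_k C k by exact: bigcup_bigsetU_bigcup.
have mF k : measurable (F k : set (borelPower E n)).
  exact: closed_borelPower.
have mUC : measurable (\bigcup_k C k : set (borelPower E n)).
  exact: bigcup_measurable.
have mUO : measurable (\bigcup_k O k : set (borelPower E n)).
  exact: bigcup_measurable.
have ndF : nondecreasing_seq F.
  move=> k l kl; apply/subsetPset; rewrite /F.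
  exact: subset_bigsetU.
have e2 : 0 < e / 2 by lra.
have [k mk] := @exhaust_measure _ (borelPower E n) _ mu F (e / 2) mF ndF e2.
exists (F k), (\bigcup_k O k); split => //.
- by apply: bigcup_open => i _.
- apply: (@subset_trans _ (\bigcup_k F k)); first exact: bigcup_sup.
  by rewrite FC; apply: subset_bigcup => i _; case: (COP i).
- by apply: subset_bigcup => i _; case: (COP i).
pose A1 : set (borelPower E n) := \bigcup_k (O k `\` C k).
pose A2 : set (borelPower E n) := \bigcup_k F k `\` F k.
have mA1 : measurable A1 by apply: bigcup_measurable => i _; exact: measurableD.
have mA2 : measurable A2.
  by apply: measurableD => //; rewrite FC.
have le1 : (mu A1 <= (e / 2)%:E)%E.
  apply: (@le_trans _ _ (\sum_(i <oo) mu (O i `\` C i : set (borelPower E n)))%E).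
    by apply: measure_sigma_subadditive => // i; exact: measurableD.
  apply: le_trans (epsilon_trick0 xpredT (ltW e2)).
  by apply: lee_nneseries => // i _; apply: ltW; case: (COP i).
apply: (@le_lt_trans _ _ (mu A1 + mu A2)%E).
  apply: (@le_trans _ _ (mu (A1 `|` A2))); last exact: measureU2.
  apply: le_measure; rewrite ?inE.
  - by apply: measurableD.
  - by apply: measurableU.
  move=> x [[i _ Oix] nFx].
  have [Cix|nCix] := pselect (C i x); last by left; exists i.
  by right; split=> //; rewrite FC; exists i.
rewrite [e](_ : e = e / 2 + e / 2); last by lra.
by rewrite EFinD lee_ltD// ge0_fin_numE// (le_lt_trans le1)// ltry.
Qed.

(** The sets approximable from inside by closed and from outside by open sets form a sigma-algebra;
    it contains the open sets because they are increasing unions of closed sets. *)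
Lemma borelPower_regular (B : set (borelPower E n)) (e : R) :
  measurable B -> 0 < e ->
  exists C O : set X, [/\ closed C, open O, C `<=` B, B `<=` O &
    (mu (O `\` C : set (borelPower E n)) < e%:E)%E].
Proof.
move=> mB; suff : measurable `<=` regular by move/(_ _ mB); apply.
apply: smallest_sub; last exact: regular_open.
split.
- by apply: regular_open; exact: open0.
- by move=> A; rewrite setTD; exact: regularC.
- by move=> A; exact: regular_bigcup.
Qed.

End regularity.

End metric.

(** An injection of [D] into the natural numbers is inverted by [xget]; indices outside its range
    are sent to [point], which does no harm. *)
Lemma dense_sequence (R : realType) (E : ptopologicalType) (d : E -> E -> R)
    (D : set E) : is_metric d -> metrizes d -> countable D -> dense D ->
  exists q : nat -> E, forall (x : E) (e : R), 0 < e ->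
    exists i, d (q i) x <= e.
Proof.
move=> dm dt /countable_injP[f finj] dD.
exists (fun k => xget point [set x | D x /\ f x = k]) => x e e0.
have [y [/= xy Dy]] : [set y | d x y < e] `&` D !=set0.
  apply: dD; last exact: open_metric_ball.
  by exists x => /=; rewrite is_metric_refl.
exists (f y); rewrite (is_metric_sym dm).
have [Dz fz] : [set x | D x /\ f x = f y]
    (xget point [set x | D x /\ f x = f y]).
  by apply: xgetPex; exists y.
by rewrite (finj _ _ _ _ fz) ?inE// ltW.
Qed.

(** If no [A i] were in the ultrafilter, all their complements would be, and so would the finite
    intersection of these, which is disjoint from the union. *)
Lemma ultra_finite_exists (T : Type) (F : set_system T) (I : finType)
    (A : I -> set T) : UltraFilter F ->
  F [set x | exists i, A i x] -> exists i, F (A i).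
Proof.
move=> FU FA; apply: contrapT => /forallNP nA.
have FC : F [set x | forall i, (~` A i) x].
  apply: (@filter_forall _ _ (fun i => ~` A i) F _) => i.
  by case: (in_ultra_setVsetC (A i) FU) => // /nA.
have [x [[i Aix] /(_ i)]] := filter_ex (filterI FA FC).
exact.
Qed.

(** * Tightness in complete separable metric spaces *)

Section polish.
Context (R : realType) (E : ptopologicalType) (n : nat) (d : E -> E -> R).
Hypothesis d_metric : is_metric d.
Hypothesis d_metrizes : metrizes d.
Hypothesis d_complete : is_complete_metric d.
Variable q : nat -> E.
Hypothesis q_dense : forall (x : E) (e : R), 0 < e -> exists i, d (q i) x <= e.
Local Notation X := (topPower E n).

Definition net_cover (k N : nat) : set X :=
  [set x | forall j, exists i : 'I_N, d (q i) (x j) <= k.+1%:R^-1].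

Lemma closed_net_cover k N : closed (net_cover k N).
Proof.
rewrite (_ : net_cover k N = \bigcap_(j in [set: 'I_n])
    ((fun x : X => x j) @^-1`
      \big[setU/set0]_(i < N) [set y | d (q i) y <= k.+1%:R^-1])).
  apply: closed_bigI => j _; apply: closed_comp.
    by move=> x _; exact: continuous_topPower_coord.
  by apply: closed_bigsetU => i _; exact: closed_metric_ball.
pose B i := [set y | d (q i) y <= k.+1%:R^-1].
apply/seteqP; split=> [x h j _ /=|x h j].
  have [i hi] := h j.
  by rewrite -(bigcup_mkord N B); exists (val i) => /=.
have := h j I; rewrite /= -(bigcup_mkord N B) => -[i /= iN hi].
by exists (Ordinal iN).
Qed.

Lemma nondecreasing_net_cover k : nondecreasing_seq (net_cover k).
Proof.
move=> N M NM; apply/subsetPset => x h j; have [i hi] := h j.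
by exists (widen_ord NM i).
Qed.

Lemma bigcup_net_cover k : \bigcup_N net_cover k N = setT.
Proof.
apply/seteqP; split=> // x _.
have k0 : 0 < k.+1%:R^-1 :> R by rewrite invr_gt0.
have /choice[f fP] : forall j : 'I_n, exists i, d (q i) (x j) <= k.+1%:R^-1.
  by move=> j; exact: q_dense.
exists (\max_j f j).+1 => // j.
have fj : (f j < (\max_j f j).+1)%N by rewrite ltnS leq_bigmax.
by exists (Ordinal fj); exact: fP.
Qed.

(** Total boundedness and completeness give compactness: along an ultrafilter each coordinate stays
    near one fixed net point at every scale [k], these centres form a Cauchy sequence, and the
    ultrafilter converges to their limit. *)
Lemma compact_net_cover (N : nat -> nat) (C : set X) : closed C ->
  (forall k, C `<=` net_cover k (N k)) -> compact C.
Proof.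
move=> cC CN; rewrite compact_ultra => F FU FC.
have /choice[c cP] : forall k, exists c : 'I_n -> E, forall j,
    F [set x : X | d (c j) (x j) <= k.+1%:R^-1].
  move=> k.
  have /choice[i iP] : forall j : 'I_n, exists i : 'I_(N k),
      F [set x : X | d (q i) (x j) <= k.+1%:R^-1].
    move=> j; apply: ultra_finite_exists.
    by apply: filterS FC => x /CN; exact.
  by exists (fun j => q (i j)).
have cauchy k l j : d (c k j) (c l j) <= k.+1%:R^-1 + l.+1%:R^-1.
  have [x [/= xk xl]] := filter_ex (filterI (cP k j) (cP l j)).
  apply: le_trans (is_metric_triangle d_metric _ (x j) _) _.
  by rewrite (is_metric_sym d_metric (x j)) lerD.
have inv_le k l : (k <= l)%N -> l.+1%:R^-1 <= k.+1%:R^-1 :> R.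
  by move=> kl; rewrite lef_pV2 ?posrE// ler_nat ltnS.
have /choice[l lP] : forall j, exists l : E, (fun k => c k j) @ \oo --> l.
  move=> j; apply: d_complete => e e0.
  have e2 : 0 < e / 2 by lra.
  have [M] := ltr_add_invr e2; rewrite add0r => Me.
  exists M => i k /inv_le Mi /inv_le Mk.
  apply: le_lt_trans (cauchy _ _ _) _; apply: le_lt_trans (lerD Mi Mk) _.
  by rewrite [e]splitr ltrD.
have Fl : F --> (l : X).
  apply: nbhs_topPower => j A /d_metrizes[e e0 eA].
  have e2 : 0 < e / 2 by lra.
  have [M] := ltr_add_invr e2; rewrite add0r => Me.
  have nl : nbhs (l j) [set y | d (l j) y < e / 2].
    by apply: (d_metrizes _ _).2; exists (e / 2).
  have [M' _ M'P] := lP j _ nl.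
  have /= lc := M'P _ (leq_maxr M M').
  suff sA : [set x : X | d (c (maxn M M') j) (x j) <= (maxn M M').+1%:R^-1]
      `<=` (fun y : X => y j) @^-1` A by exact: filterS sA (cP _ j).
  move=> x /= xc; apply: eA => /=.
  apply: le_lt_trans (is_metric_triangle d_metric _ (c (maxn M M') j) _) _.
  rewrite [e]splitr; apply: ltrD => //; apply: le_lt_trans xc _.
  exact: le_lt_trans (inv_le _ _ (leq_maxl M M')) Me.
exists l; split => //; apply: contrapT => nC.
have : F (~` C).
  by apply: Fl; apply: open_nbhs_nbhs; split => //; exact: closed_openC.
by move=> /(filterI FC)/filter_ex[x []].
Qed.

Variable mu : probability (borelPower E n) R.

(** Ulam's argument: half of [e] is spent on a closed set inside [B], the other half on the sets
    covered by finite nets at all scales; the intersection is compact. *)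
Lemma borelPower_tight (B : set (borelPower E n)) (e : R) :
  measurable B -> 0 < e ->
  exists K : set X, [/\ compact K, closed K, K `<=` B &
    (mu (B `\` K : set (borelPower E n)) < e%:E)%E].
Proof.
move=> mB e0.
have e4 (k : nat) : 0 < e / 2 / (2 ^ k.+1)%:R.
  by rewrite !divr_gt0// ltr0n expn_gt0.
have mN k N : measurable (net_cover k N : set (borelPower E n)).
  by apply: closed_borelPower; exact: closed_net_cover.
have /choice[N NP] : forall k, exists N,
    (mu (~` net_cover k N : set (borelPower E n)) <
      (e / 2 / (2 ^ k.+1)%:R)%:E)%E.
  move=> k; have [N h] := @exhaust_measure _ (borelPower E n) _ mu
    (net_cover k) _ (mN k) (nondecreasing_net_cover k) (e4 k).
  by exists N; rewrite -setTD -(bigcup_net_cover k).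
have e2 : 0 < e / 2 by lra.
have [C [V [cC oV CB BV VC]]] := borelPower_regular d_metric d_metrizes mu mB e2.
pose L : set X := \bigcap_k net_cover k (N k).
have cL : closed L by apply: closed_bigI => k _; exact: closed_net_cover.
have cK : closed (C `&` L) by exact: closedI.
exists (C `&` L); split => //.
- by apply: (compact_net_cover cK) => k x [_]; exact.
- by move=> x [/CB].
pose A1 : set (borelPower E n) := \bigcup_k ~` net_cover k (N k).
pose A2 : set (borelPower E n) := V `\` C.
have mA1 : measurable A1.
  by apply: bigcup_measurable => i _; exact: measurableC.
have mA2 : measurable A2.
  by apply: measurableD; [exact: open_borelPower|exact: closed_borelPower].
have le1 : (mu A1 <= (e / 2)%:E)%E.
  apply: (@le_trans _ _ (\sum_(i <oo)
      mu (~` net_cover i (N i) : set (borelPower E n)))%E).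
    by apply: measure_sigma_subadditive => // i; exact: measurableC.
  apply: le_trans (epsilon_trick0 xpredT (ltW e2)).
  by apply: lee_nneseries => // i _; apply: ltW.
apply: (@le_lt_trans _ _ (mu A1 + mu A2)%E).
  apply: (@le_trans _ _ (mu (A1 `|` A2))); last exact: measureU2.
  apply: le_measure; rewrite ?inE.
  - by apply: measurableD => //; exact: closed_borelPower.
  - by apply: measurableU.
  move=> x [Bx nK].
  have [Cx|nCx] := pselect (C x); last by right; split=> //; exact: BV.
  left; apply: contrapT => nA1; apply: nK; split=> // k _.
  by apply: contrapT => nk; apply: nA1; exists k.
rewrite [e](_ : e = e / 2 + e / 2); last by lra.
by rewrite EFinD lee_ltD// ge0_fin_numE// (le_lt_trans le1)// ltry.
Qed.

End polish.

(** * Sets of coordinates separating a point from a compact set *)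

Lemma finite_fibre_pair (dT : measure_display) (T : measurableType dT)
    (I J : finType) (f : T -> I) (g : T -> J) :
  (forall i, measurable (f @^-1` [set i])) ->
  (forall j, measurable (g @^-1` [set j])) ->
  forall t, measurable ((fun x => (f x, g x)) @^-1` [set t]).
Proof.
move=> mf mg [i j].
rewrite (_ : _ @^-1` _ = f @^-1` [set i] `&` g @^-1` [set j]).
  exact: measurableI.
by apply/seteqP; split=> x /= => [[-> ->]//|[-> ->]].
Qed.

Lemma finite_fibre_comp (dT dU : measure_display) (T : measurableType dT)
    (U : measurableType dU) (I : finType) (f : U -> I) (h : T -> U) :
  measurable_fun setT h -> (forall i, measurable (f @^-1` [set i])) ->
  forall i, measurable ((fun x => f (h x)) @^-1` [set i]).
Proof.
by move=> mh mf i; have := mh measurableT _ (mf i); rewrite setTI.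
Qed.

Lemma finite_fibre_set (dT : measure_display) (T : measurableType dT)
    (I : finType) (B : I -> T -> bool) :
  (forall i, measurable [set x | B i x]) ->
  forall S : {set I}, measurable ((fun x => finset (B^~ x)) @^-1` [set S]).
Proof.
move=> mB S.
rewrite (_ : _ @^-1` _ = \bigcap_(i in [set: I])
    (if i \in S then [set x | B i x] else ~` [set x | B i x])).
  apply: fin_bigcap_measurable => [|i _]; first exact: finite_finset.
  by case: ifP => _ //; exact: measurableC.
apply/seteqP; split=> [x /= <- i _|x h].
  by rewrite inE; case: ifP => //= ->.
apply/setP => i; have := h i Logic.I; rewrite inE.
by case: ifP => _ //=; case: (B i x).
Qed.

Section patterns.
Context (E : ptopologicalType) (n : nat).
Local Notation X := (topPower E n).

Definition mismatch (x y : X) : {set 'I_n} := finset (fun j => x j != y j).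

Lemma mismatchC (x y : X) : mismatch x y = mismatch y x.
Proof. by apply/setP => j; rewrite !inE eq_sym. Qed.

(* A superset of a pattern in the class is again in the class, which makes the
   class a measurable function of [x] when [K] is compact. *)
Definition mismatch_class (K : set X) (x : X) : {set {set 'I_n}} :=
  finset (fun s : {set 'I_n} => `[< exists2 y, K y & mismatch x y \subset s >]).

Lemma mismatch_classP (K : set X) (x : X) (s : {set 'I_n}) :
  reflect (exists2 y, K y & mismatch x y \subset s) (s \in mismatch_class K x).
Proof. by rewrite inE; exact: asboolP. Qed.

Lemma mem_mismatch_class (K : set X) (x y : X) :
  K y -> mismatch x y \in mismatch_class K x.
Proof. by move=> Ky; apply/mismatch_classP; exists y. Qed.

(** If [x] and [z] agree off [s], then [y] and [z] agree off [s] enlarged by the coordinates where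
    [x] and [y] differ. The move from [x] to [y] thus controls the change of class. *)
Lemma mismatch_classU (K : set X) (x y : X) (s : {set 'I_n}) :
  s \in mismatch_class K x -> s :|: mismatch x y \in mismatch_class K y.
Proof.
move=> /mismatch_classP[z Kz xz]; apply/mismatch_classP; exists z => //.
apply/fintype.subsetP => j; rewrite !inE => yz.
have [//|xy] := eqVneq (x j) (y j); last by rewrite orbT.
by move=> xy; rewrite (fintype.subsetP xz)// inE xy.
Qed.

(** The class of a point determines whether the point lies in [K], so conditioning on [K] has a
    density that is a function of the class. *)
Lemma mismatch_class_set0 (K : set X) (x : X) :
  (finset.set0 \in mismatch_class K x) = `[< K x >].
Proof.
apply/mismatch_classP/asboolP => [[y Ky]|Kx].
  rewrite finset.subset0 => /eqP h; suff -> : x = y by [].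
  apply/funext => j; apply/eqP/negPn; apply/negP => xy.
  by have := finset.in_set0 j; rewrite -h inE xy.
by exists x => //; apply/fintype.subsetP => j; rewrite inE eqxx.
Qed.

(** Erasing the coordinates in [s] turns agreement off [s] into equality, so that [s] belongs to the
    class of [x] exactly when the masked [x] lies in the masked image of [K]. *)
Definition mask_coords (s : {set 'I_n}) (x : X) : X :=
  fun j => if j \in s then point else x j.

Lemma continuous_mask_coords s : continuous (mask_coords s).
Proof.
move=> x; apply: nbhs_topPower => j.
change ((fun y : X => mask_coords s y j) @ x --> mask_coords s x j).
rewrite /mask_coords; case: ifP => _; first exact: cvg_cst.
exact: continuous_topPower_coord.
Qed.

Lemma mismatch_classE (K : set X) s :
  [set x : X | s \in mismatch_class K x] =
  mask_coords s @^-1` (mask_coords s @` K).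
Proof.
apply/seteqP; split=> [x /mismatch_classP[y Ky xy]|x [y Ky xy]].
  exists y => //; apply/funext => j; rewrite /mask_coords; case: ifPn => // js.
  apply/esym/eqP/negPn; apply: contra js => xyj.
  by rewrite (fintype.subsetP xy)// inE.
apply/mismatch_classP; exists y => //; apply/fintype.subsetP => j; rewrite inE.
apply: contraR => js; have := congr1 (fun z : X => z j) xy.
by rewrite /mask_coords (negbTE js) => ->.
Qed.

(** The masked image of a compact set is compact, hence closed in a Hausdorff space, so each event
    [s \in mismatch_class K x] is closed. *)
Lemma measurable_mismatch_class (K : set X) : hausdorff_space E -> compact K ->
  forall S, measurable
    ((mismatch_class K : borelPower E n -> _) @^-1` [set S]).
Proof.
move=> hE cK; apply: finite_fibre_set => s.
apply: closed_borelPower.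
rewrite (_ : mkset _ = [set x : X | s \in mismatch_class K x]); last first.
  by apply: eq_set => x; rewrite finset.in_set.
rewrite mismatch_classE; apply: closed_comp.
  by move=> x _; exact: continuous_mask_coords.
apply: compact_closed.
  by apply: (@hausdorff_product _ (fun=> E)) => _.
apply: continuous_compact => //.
by apply: continuous_subspaceT => x; exact: continuous_mask_coords.
Qed.

(** Distinct coordinates are separated by one of countably many closed balls around the points
    [q i], so the event that they differ is a countable union of measurable rectangles. *)
Lemma measurable_mismatch (R : realType) (d : E -> E -> R) (q : nat -> E) :
  is_metric d -> metrizes d ->
  (forall (x : E) (e : R), 0 < e -> exists i, d (q i) x <= e) ->
  forall t, measurable ((fun p : borelPower E n * borelPower E n =>
    mismatch p.1 p.2) @^-1` [set t]).
Proof.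
move=> dm dt qd; apply: finite_fibre_set => j.
have mB i k : measurable ([set x : X | d (q i) (x j) <= k.+1%:R^-1]
    : set (borelPower E n)).
  apply: closed_borelPower.
  apply: (@closed_comp _ _ (fun x : X => x j) [set y | d (q i) y <= _]).
    by move=> x _; exact: continuous_topPower_coord.
  exact: closed_metric_ball.
rewrite (_ : mkset _ = \bigcup_i \bigcup_k
   ([set x : X | d (q i) (x j) <= k.+1%:R^-1] `*`
    ~` [set x : X | d (q i) (x j) <= k.+1%:R^-1])).
  apply: bigcup_measurable => i _; apply: bigcup_measurable => k _.
  by apply: measurableX => //; exact: measurableC.
apply/seteqP; split=> [[x y] /= xy|[x y] [i _ [k _ [/= xi yi]]]]; last first.
  by apply/eqP => xy; apply: yi; rewrite -xy.
have dxy : 0 < d (x j) (y j).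
  rewrite lt_def is_metric_ge0// andbT; apply: contra_neq xy.
  by case: dm => h _ _ /h.
have d2 : 0 < d (x j) (y j) / 2 by lra.
have [k] := ltr_add_invr d2; rewrite add0r => kd.
have k0 : 0 < k.+1%:R^-1 :> R by rewrite invr_gt0.
have [i qi] := qd (x j) _ k0.
exists i => //; exists k => //; split => //=; apply/negP; rewrite -ltNge.
have := is_metric_triangle dm (x j) (q i) (y j).
rewrite (is_metric_sym dm (x j) (q i)) => h.
move: kd qi h; set a := k.+1%:R^-1; set b := d (q i) (x j).
by set c := d (q i) (y j); lra.
Qed.

End patterns.

(** * Lower semicontinuous majorants and couplings *)

(* No measurability is needed: the library's integral of a nonnegative function
   is a supremum over the simple functions below it. *)
Lemma ge0_integral_mono (dT : measure_display) (T : measurableType dT)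
    (R : realType) (mu : {measure set T -> \bar R}) (f g : T -> \bar R) :
  (forall x, 0 <= f x)%E -> (forall x, f x <= g x)%E ->
  (\int[mu]_x f x <= \int[mu]_x g x)%E.
Proof.
move=> f0 fg; rewrite !ge0_integralTE//; last first.
  by move=> x; exact: le_trans (f0 x) (fg x).
apply: le_ereal_sup => _ [h /= hf <-]; exists h => //= x.
exact: le_trans (hf x) (fg x).
Qed.

Lemma sum_law_comp (dT : measure_display) (T : measurableType dT)
    (R : realType) (I J : finType) (tau : T -> I) (phi : I -> J)
    (mu : probability T R) (g : J -> R) :
  (forall i, measurable (tau @^-1` [set i])) ->
  \sum_i law tau mu i * g (phi i) = \sum_j law (phi \o tau) mu j * g j.
Proof.
move=> mtau; apply: EFin_inj; rewrite -!integral_finite_comp// => j.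
rewrite (_ : _ @^-1` _ = tau @^-1` [set i | phi i = j])//.
exact: measurable_finite_preimage.
Qed.

Section lsc_majorant.
Context (R : realType) (E : ptopologicalType) (n : nat) (d : E -> E -> R).
Hypothesis d_metric : is_metric d.
Hypothesis d_metrizes : metrizes d.
Local Notation X := (topPower E n).
Local Notation BX := (borelPower E n).
Context (F : finType) (sigma : BX -> F).
Hypothesis msigma : forall S, measurable (sigma @^-1` [set S]).
Context (a : F -> 'I_n -> R).
Hypothesis a_ge0 : forall S j, 0 <= a S j.

(** The supremum in [weak_W] runs over lower semicontinuous weights only. Each fibre of [sigma] is
    enlarged to an open set of nearly the same mass, and [a] is summed over the enlarged fibres
    containing the point. *)
Lemma lsc_majorant (Q : probability BX R) (eta : R) : 0 < eta ->
  exists alpha : 'I_n -> X -> R, exists s : R,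
  [/\ forall j, nonneg_lsc (alpha j),
      forall j x, a (sigma x) j <= alpha j x,
      (\sum_(j < n) \int[Q]_y ((alpha j y) ^+ 2)%:E = s%:E)%E,
      (0 < n)%N -> 0 < s &
      s <= \sum_S law sigma Q S * (\sum_j a S j ^+ 2) + eta].
Proof.
move=> eta0.
pose M := \sum_S \sum_j a S j.
have M0 : 0 <= M by apply: sumr_ge0 => S _; apply: sumr_ge0.
have aM S j : a S j <= M.
  rewrite /M (bigD1 S)//= (bigD1 j)//= -addrA lerDl addr_ge0//.
    by apply: sumr_ge0.
  by apply: sumr_ge0 => T _; apply: sumr_ge0.
pose B := 1 + M.
(* The total excess is at most [e * c]: the term [2 * M + 1] comes from adding [e] to the weights,
   the term with [B ^+ 2] from the overlaps of the enlarged fibres. *)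
pose c := n%:R * (2 * M + 1 + B ^+ 2 * #|F|%:R).
have c0 : 0 <= c.
  have ? : 0 <= B ^+ 2 * #|F|%:R by rewrite mulr_ge0// sqr_ge0.
  by rewrite mulr_ge0//; lra.
pose e := Num.min 1 (eta / (c + 1)).
have e0 : 0 < e by rewrite lt_min ltr01 divr_gt0// ltr_wpDl.
have e1 : e <= 1 by rewrite ge_min lexx.
have ec : e * c <= eta.
  apply: (@le_trans _ _ (eta / (c + 1) * (c + 1))).
    by rewrite ler_pM// ?(ltW e0)// ?ge_min ?lexx ?orbT// lerDl.
  by rewrite divfK// gt_eqF// ltr_wpDl.
have /choice[V VP] : forall S, exists V : set X, [/\ open V,
    sigma @^-1` [set S] `<=` V &
    (Q (V `\` sigma @^-1` [set S] : set BX) < e%:E)%E].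
  move=> S; have [C [V [cC oV CB BV VC]]] :=
    borelPower_regular d_metric d_metrizes Q (msigma S) e0.
  exists V; split => //; apply: le_lt_trans VC.
  apply: le_measure; rewrite ?inE.
  - by apply: measurableD => //; exact: open_borelPower.
  - by apply: measurableD; [exact: open_borelPower|exact: closed_borelPower].
  - exact: setDS.
have oV S : open (V S) by case: (VP S).
have mV S : measurable (V S : set BX) by exact: open_borelPower.
have mVS S : measurable (V S `\` sigma @^-1` [set S] : set BX).
  by apply: measurableD.
(* The new weights depend only on the set of enlarged fibres containing [x], so with this
   finite-valued [tau] all integrals remain finite sums. *)
pose tau (x : BX) : F * {set F} := (sigma x, finset (fun S => `[< V S x >])).
have mtau : forall t, measurable (tau @^-1` [set t]).
  apply: finite_fibre_pair => //; apply: finite_fibre_set => S.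
  rewrite (_ : mkset _ = V S)//.
  by apply/seteqP; split=> x /asboolP.
have tauV x : (tau x).1 \in (tau x).2.
  by rewrite inE; apply/asboolP; case: (VP (sigma x)) => _ h _; exact: h.
(* The summand [e] keeps the total weight [s] positive, which makes it a legitimate divisor. *)
pose h (U : {set F}) (j : 'I_n) := e + \sum_(S in U) a S j.
pose alpha j (x : X) := h (tau x).2 j.
pose s := \sum_j \sum_t law tau Q t * h t.2 j ^+ 2.
have h_ge0 U j : 0 <= h U j.
  by rewrite /h addr_ge0 ?(ltW e0)//; apply: sumr_ge0.
exists alpha, s; split.
- move=> j; split=> [x|x r /= rx]; first exact: h_ge0.
  have : nbhs x [set y : X | forall S, V S x -> V S y].
    apply: (@filter_forall _ _ (fun S (y : X) => V S x -> V S y) (nbhs x) _).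
    move=> S; have [VSx|nV] := pselect (V S x); last by apply: nearW.
    have nV : nbhs x (V S) by apply: open_nbhs_nbhs.
    exact: filterS nV.
  exists [set y : X | forall S, V S x -> V S y] => // y hy.
  apply: (lt_le_trans rx); rewrite lee_fin lerD2l.
  rewrite [leLHS]big_mkcond [leRHS]big_mkcond /=; apply: ler_sum => S _.
  rewrite !inE; case: asboolP => [/hy Vy|_]; last by case: ifP.
  by rewrite (asboolT Vy).
- move=> j x; rewrite /alpha /h (bigD1 (sigma x)) ?tauV//=.
  by rewrite addrCA lerDl addr_ge0 ?(ltW e0)//; apply: sumr_ge0.
- rewrite /s -sumEFin; apply: eq_bigr => j _.
  exact: (integral_finite_comp mtau Q (fun t => h t.2 j ^+ 2)).
- move=> n0; apply: (@lt_le_trans _ _ (\sum_(j < n) \sum_t law tau Q t * e ^+ 2)).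
    under eq_bigr do rewrite -mulr_suml sum_law// mul1r.
    by rewrite sumr_const card_ord pmulrn_rgt0// exprn_gt0.
  apply: ler_sum => j _; apply: ler_sum => t _; apply: ler_wpM2l.
    exact: law_ge0.
  by rewrite ler_sqr ?nnegrE ?(ltW e0)// /h lerDl; apply: sumr_ge0.
(* [bad] marks the points lying in an enlarged fibre other than their own; their mass is at most
   [#|F|%:R * e]. *)
- pose bad (t : F * {set F}) := t.2 != finset (fun S => S == t.1).
  have hB U j : h U j <= B.
    apply: lerD => //; rewrite big_mkcond /=; apply: ler_sum => S _.
    case: ifP => _; last by apply: sumr_ge0.
    by rewrite (bigD1 j)//= lerDl; apply: sumr_ge0.
  have pointwise t j : h t.2 j ^+ 2 <=
      (a t.1 j ^+ 2 + e * (2 * M + 1)) + B ^+ 2 * (bad t)%:R.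
    have [tb|] := boolP (bad t).
      rewrite mulr1; apply: (@le_trans _ _ (B ^+ 2)).
        by rewrite ler_sqr ?nnegrE// /B addr_ge0.
      rewrite lerDr addr_ge0 ?sqr_ge0// mulr_ge0 ?(ltW e0)//.
      by rewrite addr_ge0// mulr_ge0.
    rewrite negbK => /eqP tE; rewrite mulr0 addr0 /h tE.
    rewrite (big_pred1 t.1); last by move=> S; rewrite inE.
    have : e * a t.1 j <= e * M by rewrite ler_wpM2l// ltW.
    have : e * e <= e * 1 by rewrite ler_wpM2l// ltW.
    have -> : (e + a t.1 j) ^+ 2 =
        a t.1 j ^+ 2 + 2 * (e * a t.1 j) + e * e by ring.
    by move=> ee ea; rewrite -addrA lerD2l mulrDr mulr1 mulrCA; lra.
  have badE : \sum_t law tau Q t * (bad t)%:R <= #|F|%:R * e.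
    rewrite -lee_fin -(integral_finite_comp mtau Q (fun t => (bad t)%:R)).
    apply: (@le_trans _ _ (\sum_S (\int[Q]_x
        (\1_(V S `\` sigma @^-1` [set S]) x)%:E))%E); last first.
      rewrite mulrC mulr_natr -sumr_const -sumEFin; apply: lee_sum => S _.
      by rewrite integral_indic// setIT; apply: ltW; case: (VP S).
    rewrite -ge0_integral_sum//; last first.
      by move=> S; apply/measurable_EFinP; exact: measurable_indic.
    apply: ge0_integral_mono => x; first by rewrite lee_fin.
    rewrite sumEFin lee_fin; case: (boolP (bad _)) => [xb|_]; last first.
      by apply: sumr_ge0 => S _; rewrite indicE.
    have [S VS xS] : exists2 S, V S x & sigma x != S.
      apply: contrapT => nS; move: xb; apply/negP/negPn/eqP/setP => S /=.
      rewrite !inE eq_sym; apply/asboolP/eqP => [VS|<-].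
        by apply/eqP/negPn/negP => xS; apply: nS; exists S.
      by case: (VP (sigma x)) => _ VS _; exact: VS.
    rewrite (bigD1 S)//= indicE mem_set ?lerDl.
      by apply: sumr_ge0 => ? _; rewrite indicE.
    by split=> //; apply/eqP.
  rewrite /s exchange_big /=.
  apply: (@le_trans _ _ (\sum_t law tau Q t * ((\sum_j a t.1 j ^+ 2) +
      n%:R * (e * (2 * M + 1)) + n%:R * B ^+ 2 * (bad t)%:R))).
    apply: ler_sum => t _; rewrite -mulr_sumr ler_wpM2l ?law_ge0//.
    apply: (le_trans (ler_sum _ (fun j _ => pointwise t j))).
    rewrite !big_split /= !sumr_const card_ord.
    by rewrite -[X in _ + X + _]mulr_natl -[X in _ + X]mulr_natl mulrA.
  rewrite (eq_bigr (fun t => law tau Q t * (\sum_j a t.1 j ^+ 2) +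
      law tau Q t * (n%:R * (e * (2 * M + 1))) +
      law tau Q t * (n%:R * B ^+ 2 * (bad t)%:R))); last first.
    by move=> t _; rewrite !mulrDr.
  rewrite !big_split /= -mulr_suml sum_law// mul1r.
  rewrite (sum_law_comp fst Q (fun S => \sum_j a S j ^+ 2))//.
  rewrite -addrA lerD2l.
  have -> : \sum_t law tau Q t * (n%:R * B ^+ 2 * (bad t)%:R) =
      n%:R * B ^+ 2 * \sum_t law tau Q t * (bad t)%:R.
    by rewrite mulr_sumr; apply: eq_bigr => t _; ring.
  apply: le_trans ec; rewrite /c.
  have : n%:R * B ^+ 2 * \sum_t law tau Q t * (bad t)%:R <=
      n%:R * B ^+ 2 * (#|F|%:R * e).
    by rewrite ler_wpM2l// mulr_ge0// sqr_ge0.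
  by set z := \sum_t _; lra.
Qed.

End lsc_majorant.

Lemma sum_law_fst (dT : measure_display) (T : measurableType dT)
    (R : realType) (I J : finType) (f : T -> I) (g : T -> J)
    (mu : probability T R) (i : I) :
  (forall t, measurable ((fun x => (f x, g x)) @^-1` [set t])) ->
  \sum_j law (fun x => (f x, g x)) mu (i, j) = law f mu i.
Proof.
move=> mfg; have := sum_law_comp fst mu (fun k => (k == i)%:R : R) mfg.
rewrite (_ : fst \o _ = f)// => h.
transitivity (\sum_k law f mu k * (k == i)%:R); last first.
  by rewrite (bigD1 i)//= eqxx mulr1 big1 ?addr0// => k /negbTE ->; rewrite mulr0.
rewrite -h; transitivity (\sum_k \sum_j
    law (fun x => (f x, g x)) mu (k, j) * (k == i)%:R); last first.
  by rewrite pair_bigA /=; apply: eq_bigr => -[k j].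
rewrite (bigD1 i)//= [X in _ + X]big1 ?addr0.
  by apply: eq_bigr => j _; rewrite eqxx mulr1.
by move=> k /negbTE ->; rewrite big1// => j _; rewrite mulr0.
Qed.

(** In the limit [e = 0] the assumption becomes [x <= w * Num.sqrt x]. One sufficiently small [e]
    already contradicts [w ^+ 2 < x]. *)
Lemma le_sqr_of_le_sqrt (R : realType) (x w : R) : 0 <= x -> 0 <= w ->
  (forall e, 0 < e -> x <= (w + e) * Num.sqrt (x + e)) -> x <= w ^+ 2.
Proof.
move=> x0 w0 h; rewrite leNgt; apply/negP => wx.
have xp : 0 < x by apply: le_lt_trans wx; exact: sqr_ge0.
(* For [e <= 1], squaring the assumption gives [x ^+ 2 <= w ^+ 2 * x + e * c]. *)
pose c := (2 * w + 1) * (x + 1) + w ^+ 2.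
have c0 : 0 < c.
  by rewrite ltr_wpDr ?sqr_ge0// mulr_gt0//; lra.
have gap : 0 < x * (x - w ^+ 2) by rewrite mulr_gt0// subr_gt0.
pose e := Num.min 1 (x * (x - w ^+ 2) / (2 * c)).
have e0 : 0 < e by rewrite lt_min ltr01 divr_gt0// mulr_gt0.
have e1 : e <= 1 by rewrite ge_min lexx.
have ec : e * (2 * c) <= x * (x - w ^+ 2).
  by rewrite -ler_pdivlMr ?mulr_gt0// ge_min lexx orbT.
have := h e e0; rewrite -(@ler_sqr _ x) ?nnegrE//; last first.
  by rewrite mulr_ge0 ?sqrtr_ge0// addr_ge0// ltW.
rewrite exprMn sqr_sqrtr; last by rewrite addr_ge0// ltW.
have -> : (w + e) ^+ 2 * (x + e) =
  w ^+ 2 * x + e * ((2 * w + e) * (x + e) + w ^+ 2) by ring.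
have : e * ((2 * w + e) * (x + e) + w ^+ 2) <= e * c.
  rewrite ler_wpM2l ?(ltW e0)// lerD2r ler_pM// ?addr_ge0 ?mulr_ge0 ?(ltW e0)//.
    by rewrite lerD2l.
  by rewrite lerD2l.
have -> : x ^+ 2 = w ^+ 2 * x + x * (x - w ^+ 2) by ring.
move=> h1 h2; have ec0 : 0 < e * c by rewrite mulr_gt0.
have : e * (2 * c) = 2 * (e * c) by ring.
by move: h1 h2 ec gap ec0; set y := x * _; set z := e * c; lra.
Qed.

Section couplings.
Context (R : realType) (E : ptopologicalType) (n : nat) (d : E -> E -> R).
Hypothesis n_gt0 : (0 < n)%N.
Hypothesis d_metric : is_metric d.
Hypothesis d_metrizes : metrizes d.
Local Notation X := (topPower E n).
Local Notation BX := (borelPower E n).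
Hypothesis m_mismatch : forall t,
  measurable ((fun p : BX * BX => mismatch p.1 p.2) @^-1` [set t]).

Section coupling_cost.
Context (F : finType) (sigma : BX -> F).
Hypothesis msigma : forall S, measurable (sigma @^-1` [set S]).
Context (a : F -> 'I_n -> R).
Hypothesis a_ge0 : forall S j, 0 <= a S j.

Let msigma2 t :
  measurable ((fun p : BX * BX => (sigma p.2, mismatch p.1 p.2)) @^-1` [set t]).
Proof.
apply: finite_fibre_pair => //.
exact: (finite_fibre_comp measurable_snd msigma).
Qed.

(** The weights are replaced by lower semicontinuous majorants whose squared norm exceeds theirs by
    at most [eta], and the infimum supplies a nearly optimal coupling. Passing back from the
    majorants to [a] only lowers the cost. *)
Lemma weak_W_coupling (P Q : probability BX R) (w eta : R) :
  0 <= w -> (weak_W P Q <= w%:E)%E -> 0 < eta ->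
  exists2 pi : probability (BX * BX)%type R, is_coupling P Q pi &
    \sum_t law (fun p : BX * BX => (sigma p.2, mismatch p.1 p.2)) pi t *
      (\sum_(j in t.2) a t.1 j) <=
    (w + eta) * Num.sqrt (\sum_S law sigma Q S * (\sum_j a S j ^+ 2) + eta).
Proof.
move=> w0 Ww eta0.
have [alpha [s [lsc aalpha sE /(_ n_gt0) s0 sle]]] :=
  lsc_majorant d_metric d_metrizes msigma a_ge0 Q eta0.
have : (ereal_inf [set weak_cost Q alpha pi | pi in is_coupling P Q] <
    (w + eta)%:E)%E.
  apply: (@le_lt_trans _ _ w%:E); last by rewrite lte_fin; lra.
  by apply: le_trans Ww; apply: ereal_sup_ubound; exists alpha.
move=> /ereal_inf_lt[_ [pi cpi <-] cost]; exists pi => //.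
rewrite -lee_fin -(integral_finite_comp msigma2 pi
  (fun t => \sum_(j in t.2) a t.1 j)).
apply: (@le_trans _ _ ((w + eta) * Num.sqrt s)%:E); last first.
  by rewrite lee_fin ler_wpM2l ?ler_wsqrtr//; lra.
move: cost; rewrite /weak_cost sE.
have ss0 : 0 < Num.sqrt s by rewrite sqrtr_gt0.
have -> : sqrte s%:E = (Num.sqrt s)%:E by [].
rewrite inver gt_eqF// => /ltW cost.
have {}cost : (\sum_(j < n) \int[pi]_p
    (alpha j p.2 * (p.1 j != p.2 j)%:R)%:E <= ((w + eta) * Num.sqrt s)%:E)%E.
  by rewrite EFinM -lee_pdivrMr.
apply: le_trans cost.
pose f j (t : F * {set 'I_n}) := a t.1 j * (j \in t.2)%:R.
have fE (p : BX * BX) : (\sum_(j in mismatch p.1 p.2) a (sigma p.2) j)%:E =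
    (\sum_j (f j (sigma p.2, mismatch p.1 p.2))%:E)%E.
  rewrite sumEFin big_mkcond /=; congr EFin; apply: eq_bigr => j _.
  by rewrite /f /=; case: ifP => _; rewrite ?mulr1 ?mulr0.
rewrite (eq_integral (fun p : BX * BX => \sum_j
  (f j (sigma p.2, mismatch p.1 p.2))%:E)%E); last by move=> p _; rewrite -fE.
rewrite integral_sum//; last by move=> j; exact: integrable_finite_comp.
apply: lee_sum => j _; apply: ge0_integral_mono => p.
  by rewrite lee_fin /f mulr_ge0.
by rewrite lee_fin /f inE ler_wpM2r// aalpha.
Qed.

End coupling_cost.

(** * Composing the couplings of [PK], [P] and [Q] *)

Section transport.
Variable K : set X.
Hypothesis mK : measurable (K : set BX).
Local Notation F := {set {set 'I_n}}.
Local Notation sigma := (mismatch_class K : BX -> F).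
Hypothesis msigma : forall S, measurable (sigma @^-1` [set S]).

(** The weights of both couplings have mean square at most [x], those given by [cond_mean] through
    Jensen's inequality, so [finite_transport] yields [x <= (w1 + w2) * Num.sqrt x] up to [e]. *)
Lemma transport_cost_le (P PK Q : probability BX R) (w1 w2 : R)
    (a : F -> 'I_n -> R) (v : F -> R) :
  0 <= w1 -> 0 <= w2 -> (weak_W PK P <= w1%:E)%E -> (weak_W P Q <= w2%:E)%E ->
  PK K = 1%E ->
  (forall S j, 0 <= a S j) ->
  (forall (S : F) s, s \in S -> v S <= \sum_(j in s) a S j) ->
  (forall S, \sum_j a S j ^+ 2 <= v S) ->
  \sum_S law sigma Q S * v S <= (w1 + w2) ^+ 2.
Proof.
move=> w10 w20 W1 W2 PK1 a0 va av.
set x := \sum_S _.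
have v0 S : 0 <= v S by apply: le_trans (av S); apply: sumr_ge0 => j _; exact: sqr_ge0.
have x0 : 0 <= x by apply: sumr_ge0 => S _; rewrite mulr_ge0// law_ge0.
apply: le_sqr_of_le_sqrt => //; first exact: addr_ge0.
move=> e e0; pose eta := e / 2.
have eta0 : 0 < eta by rewrite divr_gt0.
have [pi2 cpi2 cost2] := weak_W_coupling msigma a0 w20 W2 eta0.
pose tau2 (p : BX * BX) := (sigma p.1, sigma p.2, mismatch p.1 p.2).
have mfst : forall S, measurable ((fun p : BX * BX => sigma p.1) @^-1` [set S]).
  exact: (finite_fibre_comp measurable_fst msigma).
have msnd : forall S, measurable ((fun p : BX * BX => sigma p.2) @^-1` [set S]).
  exact: (finite_fibre_comp measurable_snd msigma).
have mtau2 : forall t, measurable (tau2 @^-1` [set t]).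
  by apply: finite_fibre_pair => //; exact: finite_fibre_pair.
pose r S T dd := law tau2 pi2 (S, T, dd).
have r0 S T dd : 0 <= r S T dd by exact: law_ge0.
have sum_r (g : F -> F -> {set 'I_n} -> R) :
    \sum_S \sum_T \sum_dd r S T dd * g S T dd =
    \sum_t law tau2 pi2 t * g t.1.1 t.1.2 t.2.
  rewrite (pair_bigA _ (fun S T => \sum_dd r S T dd * g S T dd)) /=.
  rewrite (pair_bigA _ (fun ST dd => r ST.1 ST.2 dd * g ST.1 ST.2 dd)) /=.
  by apply: eq_bigr => -[[S T] dd].
have law2 (g : F -> R) :
    \sum_S \sum_T \sum_dd r S T dd * g T = \sum_T law sigma Q T * g T.
  rewrite (sum_r (fun _ T _ => g T)) (sum_law_comp (fun t => t.1.2))//.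
  apply: eq_bigr => T _; congr (_ * _); rewrite /law; congr fine.
  by have [_ <-] := cpi2 _ (msigma T).
have marg1 S : first_marginal r S = law sigma P S.
  transitivity (\sum_k law sigma P k * (k == S)%:R); last first.
    rewrite (bigD1 S)//= eqxx mulr1 big1 ?addr0// => k /negbTE ->.
    by rewrite mulr0.
  have -> : \sum_k law sigma P k * (k == S)%:R =
      \sum_t law tau2 pi2 t * (t.1.1 == S)%:R.
    rewrite (sum_law_comp (fun t => t.1.1) pi2 (fun k => (k == S)%:R))//.
    apply: eq_bigr => k _; congr (_ * _); rewrite /law; congr fine.
    by have [<- _] := cpi2 _ (msigma k).
  rewrite -(sum_r (fun S' _ _ => (S' == S)%:R)) (bigD1 S)//= [X in _ + X]big1.
    rewrite addr0 /first_marginal; apply: eq_bigr => T _; apply: eq_bigr => dd _.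
    by rewrite eqxx mulr1.
  move=> S' /negbTE ->; rewrite big1// => T _; rewrite big1// => dd _.
  by rewrite mulr0.
(* These weights depend on the law of [pi2], so the coupling [pi1] of [PK] and [P] is chosen only
   now. *)
pose b := cond_mean r a.
have b0 S j : 0 <= b S j by exact: cond_mean_ge0.
have [pi1 cpi1 cost1] := weak_W_coupling msigma b0 w10 W1 eta0.
pose tau1 (p : BX * BX) := (sigma p.2, mismatch p.1 p.2).
have mtau1 : forall t, measurable (tau1 @^-1` [set t]).
  exact: finite_fibre_pair.
pose q S dd := law tau1 pi1 (S, dd).
have qp S : \sum_dd q S dd = first_marginal r S.
  rewrite marg1 /q sum_law_fst// /law; congr fine.
  by have [_ <-] := cpi1 _ (msigma S).
(* The first point of [pi1] lies in [K] almost surely, so its mismatch with the second point is a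
   pattern in the class of the latter. *)
have qS S dd : q S dd != 0 -> dd \in S.
  apply: contraNT => ddS; apply/eqP/EFin_inj.
  rewrite /q lawE//; apply/eqP; rewrite eq_le measure_ge0 andbT.
  have mKC : measurable (~` (K : set BX)) by exact: measurableC.
  have PKC : PK (~` (K : set BX)) = 0%E.
    transitivity (1 - PK K)%E; first exact: probability_setC.
    by rewrite PK1 subee.
  apply: (@le_trans _ _ (pi1 (fst @^-1` ~` (K : set BX)))); last first.
    by have [-> _] := cpi1 _ mKC; rewrite PKC.
  apply: le_measure; rewrite ?inE//.
    by rewrite -[X in measurable X]setTI; exact: measurable_fst.
  move=> p [pS pd] Kp; move: ddS.
  by rewrite -pS -pd mismatchC mem_mismatch_class.
(* A fibre of positive mass contains an actual pair of points, to which [mismatch_classU]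
   applies. *)
have rST S T dd (s : {set 'I_n}) : r S T dd != 0 -> s \in S -> s :|: dd \in T.
  move=> rn; have [p [[pS pT pd]]] : tau2 @^-1` [set (S, T, dd)] !=set0.
    apply/set0P; apply: contra rn => /eqP h.
    by rewrite /r /law h measure0.
  by rewrite -pS -pT -pd; exact: mismatch_classU.
have := finite_transport r0 (fun S dd => law_ge0 tau1 pi1 (S, dd)) qp qS va a0 rST.
rewrite law2 -/x; move/le_trans; apply.
have -> : w1 + w2 + e = (w1 + eta) + (w2 + eta) by rewrite /eta; lra.
rewrite mulrDl; apply: lerD.
- rewrite (pair_bigA _ (fun S dd => law tau1 pi1 (S, dd) *
      \sum_(j in dd) cond_mean r a S j)) /=.
  rewrite (eq_bigr (fun t => law tau1 pi1 t * \sum_(j in t.2) b t.1 j)); last first.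
    by move=> [S dd].
  apply: (le_trans cost1); rewrite ler_wpM2l ?addr_ge0 ?(ltW eta0)//.
  rewrite ler_wsqrtr// lerD//; last by rewrite /eta; lra.
  under eq_bigr do rewrite -marg1.
  apply: (le_trans (cond_mean_sqr_le a r0)).
  rewrite (law2 (fun T => \sum_j a T j ^+ 2)); apply: ler_sum => T _.
  by rewrite ler_wpM2l ?law_ge0.
- have -> : \sum_S \sum_T \sum_dd r S T dd * (\sum_(j in dd) a T j) =
     \sum_t law (fun p : BX * BX => (sigma p.2, mismatch p.1 p.2)) pi2 t *
       \sum_(j in t.2) a t.1 j.
    rewrite (sum_r (fun _ T dd => \sum_(j in dd) a T j)).
    have h := sum_law_comp (fun t => (t.1.2, t.2)) pi2
      (fun t : F * {set 'I_n} => \sum_(j in t.2) a t.1 j) mtau2.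
    by rewrite h; apply: eq_bigr => t _; congr (_ * _).
  apply: (le_trans cost2); rewrite ler_wpM2l ?addr_ge0 ?(ltW eta0)//.
  rewrite ler_wsqrtr// lerD//; last by rewrite /eta; lra.
  by apply: ler_sum => T _; rewrite ler_wpM2l ?law_ge0.
Qed.

End transport.

End couplings.

(** * Weights realizing the convex distance *)

Lemma expe2_le (R : realType) (x : \bar R) (V W : R) :
  (0 <= x)%E -> (x <= V%:E)%E -> V ^+ 2 <= W -> (x ^+ 2 <= W%:E)%E.
Proof.
case: x => [r| |]//; rewrite !(lee_fin r V, lee_fin 0 r) => r0 rV VW.
rewrite -EFin_expe lee_fin; apply: le_trans VW.
by rewrite ler_sqr ?nnegrE//; apply: le_trans rV.
Qed.

(** Follows from [ln y <= y - 1] at [y = (g i)^-1], weighted by [p i * g i]; the sum is the relative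
    entropy of the density [g]. *)
Lemma gibbs (R : realType) (I : finType) (p g : I -> R) :
  (forall i, 0 <= p i) -> (forall i, 0 < g i) ->
  \sum_i p i = 1 -> \sum_i p i * g i = 1 ->
  0 <= \sum_i p i * g i * ln (g i).
Proof.
move=> p0 g0 p1 pg1.
apply: (@le_trans _ _ (\sum_i (p i * g i - p i))).
  by rewrite sumrB pg1 p1 subrr.
apply: ler_sum => i _; have gi := g0 i.
have : ln (g i)^-1 <= (g i)^-1 - 1.
  rewrite -[X in ln X](subrK 1) addrC; apply: le_ln1Dx.
  by rewrite ltrBrDr addNr invr_gt0.
rewrite lnV ?posrE// => h.
have : g i - 1 <= g i * ln (g i).
  rewrite -[leLHS]opprK -[leRHS]opprK lerN2 -mulrN opprB.
  have -> : 1 - g i = g i * ((g i)^-1 - 1) by field; rewrite gt_eqF.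
  by rewrite ler_pM2l.
move=> /(ler_wpM2l (p0 i)); rewrite mulrBr mulr1 mulrA; exact.
Qed.

Section talagrand.
Context (R : realType) (E : ptopologicalType) (n : nat).
Local Notation X := (topPower E n).

Lemma talagrand_dist_ge0 (x : X) (A : set X) : (0 <= talagrand_dist R x A)%E.
Proof.
apply: (@le_trans _ _ (ereal_inf
    [set (\sum_(j < n) 0 * (x j != y j)%:R : R)%:E | y in A])%E).
  apply: le_ereal_inf_tmp => _ [y _ <-].
  by rewrite big1// => j _; rewrite mul0r.
apply: ereal_sup_ubound; exists (fun=> 0) => //=.
by rewrite big1 ?sqrtr0// => j _; rewrite expr0n.
Qed.

(* [v] is the square of an almost optimal value in the minimax problem for the
   class [S], and [a] is the square root of [v] times the direction attaining it. *)
Lemma talagrand_weights (eta : R) (S : {set {set 'I_n}}) : 0 < eta ->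
  exists va : R * ('I_n -> R), [/\ forall j, 0 <= va.2 j,
    forall s, s \in S -> va.1 <= \sum_(j in s) va.2 j,
    \sum_j va.2 j ^+ 2 <= va.1 &
    forall (K A : set X) (x : X), K !=set0 -> K `<=` A ->
      mismatch_class K x = S ->
      (talagrand_dist R x A ^+ 2 <= (va.1 + eta)%:E)%E].
Proof.
move=> eta0.
(* The empty class occurs only for empty [K], which the last clause excludes. *)
have [S0|[d0 d0S]] := finset.set_0Vmem S.
  exists (0, fun=> 0); split => //=.
  - by move=> s _; rewrite big1.
  - by rewrite big1// => j _; rewrite expr0n.
  - move=> K A x [y Ky] _ xS; have := mem_mismatch_class x Ky.
    by rewrite xS S0 finset.in_set0.
pose admissible (c : 'I_n -> R) := (forall j, 0 <= c j) /\ \sum_j c j ^+ 2 <= 1.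
pose W := [set t : R | exists2 c, admissible c &
  forall s, s \in S -> t <= \sum_(j in s) c j].
have W0 : W 0.
  exists (fun=> 0); last by move=> s _; rewrite big1.
  by split=> //; rewrite big1 ?ler01// => j _; rewrite expr0n.
have hW : has_sup W.
  split; first by exists 0.
  exists n%:R => t [c [c0 c1] /(_ _ d0S) tc]; apply: (le_trans tc).
  rewrite big_mkcond /= -[n in leRHS]card_ord -sum1_card natr_sum.
  apply: ler_sum => j _; case: ifP => _ //.
  rewrite -(@ler_sqr _ (c j)) ?nnegrE// expr1n; apply: le_trans c1.
  by rewrite (bigD1 j)//= lerDl; apply: sumr_ge0 => i _; exact: sqr_ge0.
pose V := sup W.
have V0 : 0 <= V by exact: ub_le_sup hW.2 _ W0.
(* Attainment of the supremum is replaced by a [t] in [W] whose square loses at most [eta]. *)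
have [t [t0 tV tW]] : exists t, [/\ 0 <= t, V ^+ 2 <= t ^+ 2 + eta & W t].
  have [Ve|Ve] := leP (V ^+ 2) eta.
    by exists 0; split => //; rewrite expr0n add0r.
  have lt : Num.sqrt (V ^+ 2 - eta) < V.
    rewrite -[ltRHS]ger0_norm// -sqrtr_sqr ltr_sqrt; first lra.
    exact: le_lt_trans (ltW eta0) Ve.
  have [t tW lt_t] := sup_gt hW.1 lt.
  have t0 : 0 <= t by apply: ltW; apply: le_lt_trans lt_t; exact: sqrtr_ge0.
  exists t; split => //; rewrite -lerBlDr.
  rewrite -[leLHS]sqr_sqrtr; last lra.
  by rewrite ler_sqr ?nnegrE ?sqrtr_ge0// ltW.
have [c [c0 c1] cS] := tW.
exists (t ^+ 2, fun j => t * c j); split => /=.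
- by move=> j; rewrite mulr_ge0.
- by move=> s sS; rewrite -mulr_sumr expr2 ler_wpM2l// cS.
- under eq_bigr do rewrite exprMn.
  by rewrite -mulr_sumr ler_piMr ?sqr_ge0.
- move=> K A x K0 KA xS; apply: expe2_le (talagrand_dist_ge0 x A) _ tV.
  apply: ge_ereal_sup => _ [b /= b1 <-].
  (* Negative entries of [b] are replaced by 0: the norm does not grow and the sums do not
     decrease. *)
  pose b' j := Num.max 0 (b j).
  have b'0 j : 0 <= b' j by rewrite le_max lexx.
  have adm : admissible b'.
    split=> //; apply: (@le_trans _ _ (\sum_j b j ^+ 2)).
      apply: ler_sum => j _; have [bj|/ltW bj] := leP 0 (b j).
        by rewrite /b' max_r.
      by rewrite /b' max_l// expr0n sqr_ge0.
    move: b1; rewrite -[X in _ <= X]sqrtr1 ler_sqrt//.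
  (* The minimum over [S] of the sums of [b'] belongs to [W], hence is at most [V]; a point [y] of
     [K] whose mismatch lies in the minimizer bounds the infimum over [A]. *)
  have [s sS smin] := arg_minP (fun s : {set 'I_n} => \sum_(j in s) b' j) d0S.
  have [y Ky ys] : exists2 y, K y & mismatch x y \subset s.
    by apply/mismatch_classP; rewrite xS.
  apply: (@le_trans _ _ (\sum_(j < n) b j * (x j != y j)%:R)%:E).
    by apply: ereal_inf_lbound; exists y => //; exact: KA.
  rewrite lee_fin; apply: (@le_trans _ _ (\sum_(j in s) b' j)); last first.
    by apply: ub_le_sup hW.2 _ _; exists b'.
  rewrite [leRHS]big_mkcond; apply: ler_sum => j _ /=.
  case: (boolP (x j != y j)) => xy; last by rewrite mulr0; case: ifP.
  have -> : j \in s by apply: (fintype.subsetP ys); rewrite inE.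
  by rewrite mulr1 le_max lexx orbT.
Qed.

End talagrand.

(** * Exponential moments *)

Section exponential_bound.
Context (R : realType) (E : ptopologicalType) (n : nat) (d : E -> E -> R).
Hypothesis n_gt0 : (0 < n)%N.
Hypothesis d_metric : is_metric d.
Hypothesis d_metrizes : metrizes d.
Local Notation X := (topPower E n).
Local Notation BX := (borelPower E n).
Hypothesis m_mismatch : forall t,
  measurable ((fun p : BX * BX => mismatch p.1 p.2) @^-1` [set t]).
Variables (C : R) (P : probability BX R).
Hypothesis C_gt0 : 0 < C.
Hypothesis TP : weak_T C P.
Hypothesis TiP : weak_T_inv C P.

Lemma sqrt_entropy (h : R) : sqrte ((2 * C)%:E * h%:E) =
  (Num.sqrt (2 * C * h))%:E.
Proof. by []. Qed.

(* Gibbs variational principle: [Q] has density proportional to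
   [expR (v / (4 C))], which makes [x / (4 C) - H(Q|P)] equal to the logarithm of
   the exponential moment. *)
Lemma exponential_moment_le (K : set X) (k : R) (a : {set {set 'I_n}} -> 'I_n -> R)
    (v : {set {set 'I_n}} -> R) :
  measurable (K : set BX) ->
  (forall S, measurable ((mismatch_class K : BX -> _) @^-1` [set S])) ->
  P K = k%:E -> 0 < k ->
  (forall S j, 0 <= a S j) ->
  (forall (S : {set {set 'I_n}}) s, s \in S -> v S <= \sum_(j in s) a S j) ->
  (forall S, \sum_j a S j ^+ 2 <= v S) ->
  \sum_S law (mismatch_class K : BX -> _) P S * expR (v S / (4 * C)) <= k^-1.
Proof.
move=> mK msigma Pk k0 a0 va av.
set sigma : BX -> {set {set 'I_n}} := mismatch_class K.
pose inK (S : {set {set 'I_n}}) := finset.set0 \in S.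
have inKE x : inK (sigma x) = (x \in K).
  by rewrite /inK mismatch_class_set0.
have sum_inK (mu : probability BX R) :
    (\sum_S law sigma mu S * (inK S)%:R)%:E = mu K.
  rewrite -(integral_finite_comp msigma mu (fun S => (inK S)%:R)).
  rewrite (eq_integral (fun x : BX => (\1_(K : set BX) x)%:E)).
    by rewrite integral_indic ?setIT.
  by move=> x _; rewrite inKE indicE.
have p0 S : 0 <= law sigma P S by exact: law_ge0.
have k1 : k <= 1 by rewrite -lee_fin -Pk probability_le1.
(* Density of [P] conditioned on [K]; its entropy is [- ln k]. *)
pose g1 S := (inK S)%:R / k.
have g10 S : 0 <= g1 S by rewrite divr_ge0// ltW.
have sumk : \sum_S law sigma P S * (inK S)%:R = k.
  by apply: EFin_inj; rewrite sum_inK.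
have g11 : \sum_S law sigma P S * g1 S = 1.
  under eq_bigr do rewrite mulrA.
  by rewrite -mulr_suml sumk divff// gt_eqF.
have [PK [lawPK HPK]] := finite_density_exists msigma g10 g11.
have PK1 : PK K = 1%E.
  rewrite -sum_inK -[in RHS]g11; congr EFin; apply: eq_bigr => S _.
  by rewrite lawPK /g1; case: (inK S); rewrite ?mulr1// !(mul0r, mulr0).
have {}HPK : relative_entropy PK P = (- ln k)%:E.
  rewrite HPK; congr EFin; rewrite -[RHS]mul1r -[in RHS]g11 mulr_suml.
  apply: eq_bigr => S _; rewrite /g1; case: (inK S).
    by rewrite mul1r lnV ?posrE.
  by rewrite mul0r mulr0 !mul0r.
set Z := \sum_S _.
have f0 S : 0 < expR (v S / (4 * C)) by exact: expR_gt0.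
have Z0 : 0 < Z.
  rewrite lt_def sumr_ge0 ?andbT; last by move=> S _; rewrite mulr_ge0// ltW.
  apply/negP => /eqP/psumr_eq0P h.
  have p00 S : law sigma P S = 0.
    have := h _ S isT; rewrite /= => h'.
    have /eqP := h' (fun S _ => mulr_ge0 (p0 S) (ltW (f0 S))).
    by rewrite mulf_eq0 [X in _ || X]gt_eqF// orbF => /eqP.
  by have := sum_law msigma P; rewrite big1// => /eqP; rewrite eq_sym oner_eq0.
pose g2 S := expR (v S / (4 * C)) / Z.
have g2p S : 0 < g2 S by rewrite divr_gt0.
have g21 : \sum_S law sigma P S * g2 S = 1.
  under eq_bigr do rewrite mulrA.
  by rewrite -mulr_suml divff// gt_eqF.
have [Q [lawQ HQ]] := finite_density_exists msigma (fun S => ltW (g2p S)) g21.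
pose x := \sum_S law sigma Q S * v S.
have entQ : \sum_S law sigma P S * g2 S * ln (g2 S) = x / (4 * C) - ln Z.
  rewrite -[ln Z]mul1r -[X in X * ln Z]g21 /x !mulr_suml -sumrB.
  apply: eq_bigr => S _; rewrite lawQ {2}/g2 ln_div ?posrE// expRK.
  by rewrite mulrBr mulrA.
have HQ0 : 0 <= x / (4 * C) - ln Z.
  by rewrite -entQ; apply: gibbs => //; exact: sum_law.
have lnk : 0 <= - ln k by rewrite oppr_ge0 ln_le0.
have W1 : (weak_W PK P <= (Num.sqrt (2 * C * - ln k))%:E)%E.
  by rewrite -sqrt_entropy -HPK; exact: TiP.
have W2 : (weak_W P Q <= (Num.sqrt (2 * C * (x / (4 * C) - ln Z)))%:E)%E.
  by rewrite -sqrt_entropy -entQ -HQ; exact: TP.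
have := transport_cost_le n_gt0 d_metric d_metrizes m_mismatch mK msigma
  (sqrtr_ge0 _) (sqrtr_ge0 _) W1 W2 PK1 a0 va av.
rewrite -/x; set w1 := Num.sqrt _; set w2 := Num.sqrt _ => xw.
have w1E : w1 ^+ 2 = 2 * C * - ln k.
  by rewrite sqr_sqrtr// mulr_ge0// mulr_ge0// ltW.
have w2E : w2 ^+ 2 = 2 * C * (x / (4 * C) - ln Z).
  by rewrite sqr_sqrtr// mulr_ge0// mulr_ge0// ltW.
have xE : 4 * C * (x / (4 * C)) = x by rewrite mulrC divfK// gt_eqF// mulr_gt0.
(* With [(w1 + w2) ^+ 2 <= 2 * (w1 ^+ 2 + w2 ^+ 2)] the bound on [x] reads
   [x <= 4 * C * - ln k + x - 4 * C * ln Z], and [x] cancels. *)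
have ineq : 4 * C * ln Z <= 4 * C * - ln k.
  have := sqr_ge0 (w1 - w2).
  have -> : (w1 - w2) ^+ 2 = 2 * (w1 ^+ 2 + w2 ^+ 2) - (w1 + w2) ^+ 2 by ring.
  have -> : 2 * (w1 ^+ 2 + w2 ^+ 2) =
      4 * C * - ln k + (4 * C * (x / (4 * C)) - 4 * C * ln Z).
    by rewrite w1E w2E; ring.
  by rewrite xE; move: xw; set u := (_ + _) ^+ 2; lra.
have : ln Z <= ln k^-1.
  by rewrite lnV ?posrE//; move: ineq; rewrite ler_pM2l// mulr_gt0.
by rewrite ler_ln ?posrE// invr_gt0.
Qed.

(** The squared distance is at most [v] of the class of [x] plus [eta * (4 * C)]; after division by
    [4 * C] the slack becomes the factor [expR eta]. The majorant is a function of the class, hence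
    measurable. *)
Lemma talagrand_moment_compact (K A : set X) (k eta : R) :
  hausdorff_space E -> compact K -> closed K -> K `<=` A ->
  P K = k%:E -> 0 < k -> 0 < eta ->
  (\int[P]_x expeR (talagrand_dist R x A ^+ 2 / (4 * C)%:E)
    <= (expR eta / k)%:E)%E.
Proof.
move=> hE cK clK KA Pk k0 eta0.
have msigma := measurable_mismatch_class hE cK.
have mK : measurable (K : set BX) by exact: closed_borelPower.
have C4 : 0 < 4 * C by rewrite mulr_gt0.
have K0 : K !=set0.
  apply/set0P/eqP => KE; move: Pk; rewrite KE measure0 => -[k00].
  by move: k0; rewrite -k00 ltxx.
have eta4 : 0 < eta * (4 * C) by rewrite mulr_gt0.
have /choice[va vaP] := fun S => @talagrand_weights R E n _ S eta4.
pose v S := (va S).1; pose a S := (va S).2.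
have := @exponential_moment_le K k a v mK msigma Pk k0.
move=> /(_ (fun S => let: And4 h _ _ _ := vaP S in h)
  (fun S => let: And4 _ h _ _ := vaP S in h)
  (fun S => let: And4 _ _ h _ := vaP S in h)) Zk.
apply: (@le_trans _ _ (\int[P]_x
    (expR eta * expR (v (mismatch_class K x) / (4 * C)))%:E)%E).
  apply: ge0_integral_mono => x; first exact: expeR_ge0.
  rewrite -expRD -[leRHS]/(expeR (eta + v (mismatch_class K x) / (4 * C))%:E).
  rewrite lee_expeR inver gt_eqF// lee_pdivrMr// -EFinM mulrDl divfK ?gt_eqF//.
  have [_ _ _ h] := vaP (mismatch_class K x).
  by rewrite addrC; apply: h KA _.
rewrite (integral_finite_comp msigma P
  (fun S => expR eta * expR (v S / (4 * C)))) lee_fin.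
apply: (@le_trans _ _ (expR eta * k^-1)) => //.
rewrite (eq_bigr (fun S => expR eta * (law (mismatch_class K : BX -> _) P S *
  expR (v S / (4 * C))))); last by move=> S _; ring.
by rewrite -mulr_sumr ler_wpM2l// expR_ge0.
Qed.

End exponential_bound.

(** Tightness provides compact subsets of [A] of mass close to [P A], and the bounds for them pass
    to the limit; the right side is +oo when [P A] is 0. *)
Theorem proposition3p4 (R : realType) (E : ptopologicalType) (n : nat) (C : R)
    (P : probability (borelPower E n) R) :
  polish_space R E -> (1 <= n)%N -> 0 < C ->
  weak_T C P -> weak_T_inv C P ->
  forall A : set (borelPower E n), measurable A ->
    (\int[P]_x expeR (talagrand_dist R x A ^+ 2 / (4 * C)%:E) <= (P A)^-1)%E.
Proof.
move=> [[D cD dD] [d [dm dt dc]]] n0 C0 TP TiP A mA.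
have [q qd] := dense_sequence dm dt cD dD.
have hE := metrizable_hausdorff dm dt.
have mmm := @measurable_mismatch E n R d q dm dt qd.
have bound := talagrand_moment_compact n0 dm dt mmm C0 TP TiP hE.
set I := (\int[P]_x _)%E.
have I0 : (0 <= I)%E by apply: integral_ge0 => x _; exact: expeR_ge0.
have PAE : P A = (fine (P A))%:E by rewrite fineK// fin_num_measure.
set p := fine (P A) in PAE.
have p0 : 0 <= p by exact: fine_ge0.
have [pe0|pn0] := eqVneq p 0; first by rewrite PAE pe0 inve0 leey.
have pp : 0 < p by rewrite lt_def pn0.
have compact_part (e : R) : 0 < e -> e < p ->
    exists k, [/\ p - e <= k, 0 < k &
      forall eta, 0 < eta -> (I <= (expR eta / k)%:E)%E].
  move=> e0 ep.
  have [K [cK clK KA PAK]] := borelPower_tight dm dt dc qd P mA e0.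
  have mK : measurable (K : set (borelPower E n)) by exact: closed_borelPower.
  have PKE : P K = (fine (P K))%:E by rewrite fineK// fin_num_measure.
  have pk : p - e <= fine (P K).
    have : (P A <= P K + P (A `\` K))%E.
      rewrite -[X in (P X <= _)%E](setDUK KA).
      exact: measureU2 mK (measurableD mA mK).
    move=> h; have := le_trans h (leeD2l _ (ltW PAK)).
    by rewrite PAE PKE -EFinD lee_fin lerBlDr.
  have k0 : 0 < fine (P K) by apply: lt_le_trans pk; rewrite subr_gt0.
  by exists (fine (P K)); split => // eta; exact: bound cK clK KA PKE k0.
have e20 : 0 < p / 2 by rewrite divr_gt0.
(* The choice [e = p / 2], [eta = 1] serves only to show that the integral is finite. *)
have [k2 [_ _ /(_ _ ltr01) Ik]] := compact_part _ e20 (ltac:(lra)).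
have IE : I = (fine I)%:E.
  by rewrite fineK// ge0_fin_numE// (le_lt_trans Ik)// ltry.
rewrite PAE inver gt_eqF// IE lee_fin.
set i := fine I in IE *.
rewrite -div1r ler_pdivlMr// leNgt; apply/negP => ip.
have i0 : 0 < i by rewrite -(pmulr_lgt0 _ pp); apply: lt_trans ip.
(* This [e] makes [i * (p - e)] the midpoint of 1 and [i * p], hence still larger than 1. *)
pose e := (i * p - 1) / (2 * i).
have e0 : 0 < e by rewrite divr_gt0 ?subr_gt0// mulr_gt0.
have ie : i * e = (i * p - 1) / 2 by rewrite /e; field; rewrite gt_eqF.
have ep : e < p by rewrite -(ltr_pM2l i0) ie; lra.
have [k [pk k0 bk]] := compact_part e e0 ep.
have ik : 1 < i * k.
  apply: (@lt_le_trans _ _ (i * (p - e))); first by rewrite mulrBr ie; lra.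
  by rewrite ler_wpM2l// ltW.
(* With [eta] half of [ln (i * k)], the bound says that this positive logarithm is at most its own
   half. *)
have eta0 : 0 < ln (i * k) / 2 by rewrite divr_gt0// ln_gt0.
have := bk _ eta0; rewrite IE lee_fin ler_pdivlMr//.
rewrite -ler_ln ?posrE ?expR_gt0 ?mulr_gt0// expRK.
by move: eta0; set l := ln _; lra.
Qed.
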